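(* Let $(A,\varphi)$ be a selfless $C^*$-probability space with $\varphi$ nonfaithful. Then $A$ is purely infinite and simple.
   Context: A $C^*$-probability space is a pair $(A,\varphi)$ with $A$ a unital $C^*$-algebra and $\varphi$ a state on $A$. The state $\varphi$ is faithful if $a\ge 0$ and $\varphi(a)=0$ imply $a=0$; it ''induces faithful GNS'' if its GNS representation is faithful (injective). An embedding of $C^*$-probability spaces is an injective unital $*$-homomorphism that preserves the states. $(A,\varphi)*(B,\psi)$ denotes the (Voiculescu) reduced free product of $C^*$-probability spaces whose states induce faithful GNS; it is again a $C^*$-probability space, whose free product state induces faithful GNS, and it contains the factors by state-preserving unital embeddings. An embedding $\theta:(B,\psi)\hookrightarrow(A,\varphi)$ is existential if for every quantifier-free formula $\Phi(\bar x,\bar y)$ in the (continuous logic) language of $C^*$-probability spaces (i.e. a continuous real-valued combination of finitely many expressions $\|p(\bar x,\bar y)\|$ and $\varphi(p(\bar x,\bar y))$, with $p$ a $*$-polynomial, where the state symbol $\varphi$ is interpreted by the state of the space under consideration), and every tuple $\bar a$ in the unit ball of $B$, $\inf_{\bar y\in B_1}\Phi(\bar a,\bar y)^{(B,\psi)}=\inf_{\bar y\in A_1}\Phi(\theta(\bar a),\bar y)^{(A,\varphi)}$, where the infima are over tuples in the unit balls. Equivalently, for some ultrafilter $\mathscr U$ there is an embedding $\sigma:(A,\varphi)\hookrightarrow(B,\psi)^{\mathscr U}$ such that $\sigma\theta$ is the diagonal embedding. $(A,\varphi)$ is selfless if $A\neq\mathbb C$, $\varphi$ induces faithful GNS, and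 the first factor embedding $(A,\varphi)\hookrightarrow(A,\varphi)*(A,\varphi)$ is existential. A simple $C^*$-algebra is purely infinite if every nonzero hereditary $C^*$-subalgebra contains an infinite projection. *)

(* Defs.v *)
From HB Require Import structures.
From mathcomp Require Import all_boot all_order all_algebra.
From mathcomp Require Import all_classical all_reals all_analysis.
From mathcomp Require Import complex.
Set Implicit Arguments.
Unset Strict Implicit.
Unset Printing Implicit Defensive.
Import Order.TTheory GRing.Theory Num.Theory.
Import numFieldNormedType.Exports.
Local Open Scope classical_set_scope.
Local Open Scope ring_scope.
Local Open Scope complex_scope.

(* Norms of elements of a normed module over [R[i]] are elements of [R[i]];
   they are nonnegative, hence real.  The condition [cstar_one_neq0] is no
   restriction in the presence of a state.  The multiplication is a field of the
   record, rather than inherited from [algType], because the hierarchy has no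
   structure joining rings and normed modules; the canonical [algType] structure
   is built from it below. *)
Record cstarAlgType (R : realType) := CStarAlgType {
  cstar_space : completeNormedModType R[i];
  cstar_mul : cstar_space -> cstar_space -> cstar_space;
  cstar_one : cstar_space;
  cstar_star : cstar_space -> cstar_space;
  cstar_mulA : associative cstar_mul;
  cstar_mul1l : left_id cstar_one cstar_mul;
  cstar_mul1r : right_id cstar_one cstar_mul;
  cstar_mulDl : left_distributive cstar_mul +%R;
  cstar_mulDr : right_distributive cstar_mul +%R;
  cstar_one_neq0 : cstar_one != 0;
  cstar_scaleAl : forall (c : R[i]) a b,
    c *: cstar_mul a b = cstar_mul (c *: a) b;
  cstar_scaleAr : forall (c : R[i]) a b,
    c *: cstar_mul a b = cstar_mul a (c *: b);
  cstar_starK : involutive cstar_star;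
  cstar_starD : {morph cstar_star : a b / a + b};
  cstar_starZ : forall (c : R[i]) a,
    cstar_star (c *: a) = Num.conj c *: cstar_star a;
  cstar_starM : forall a b,
    cstar_star (cstar_mul a b) = cstar_mul (cstar_star b) (cstar_star a);
  cstar_normM : forall a b, `|cstar_mul a b| <= `|a| * `|b|;
  cstar_norm_star : forall a, `|cstar_mul (cstar_star a) a| = `|a| ^+ 2
}.

Definition cstar_sort (R : realType) (A : cstarAlgType R) : Type :=
  cstar_space A.
Coercion cstar_sort : cstarAlgType >-> Sortclass.

Section CStarInstances.
Variables (R : realType) (A : cstarAlgType R).
HB.instance Definition _ :=
  CompleteNormedModule.copy (cstar_sort A) (cstar_space A).
HB.instance Definition _ := GRing.Zmodule_isNzRing.Build (cstar_sort A)
  (@cstar_mulA R A) (@cstar_mul1l R A) (@cstar_mul1r R A)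
  (@cstar_mulDl R A) (@cstar_mulDr R A) (@cstar_one_neq0 R A).
HB.instance Definition _ :=
  GRing.Lmodule_isLalgebra.Build R[i] (cstar_sort A) (@cstar_scaleAl R A).
HB.instance Definition _ :=
  GRing.Lalgebra_isAlgebra.Build R[i] (cstar_sort A) (@cstar_scaleAr R A).
End CStarInstances.

Definition star (R : realType) (A : cstarAlgType R) : A -> A := @cstar_star R A.

Section CStarTheory.
Variables (R : realType) (A : cstarAlgType R).
Implicit Types a b : A.

Lemma starK a : star (star a) = a. Proof. exact: cstar_starK. Qed.
Lemma starD a b : star (a + b) = star a + star b.
Proof. exact: cstar_starD. Qed.
Lemma starZ (c : R[i]) a : star (c *: a) = Num.conj c *: star a.
Proof. exact: cstar_starZ. Qed.
Lemma starM a b : star (a * b) = star b * star a.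
Proof. exact: cstar_starM. Qed.
Lemma cnormM a b : `|a * b| <= `|a| * `|b|.
Proof. exact: cstar_normM. Qed.
Lemma cnorm_star_mul a : `|star a * a| = `|a| ^+ 2.
Proof. exact: cstar_norm_star. Qed.
End CStarTheory.

Definition cpos (R : realType) (A : cstarAlgType R) (a : A) : Prop :=
  exists b : A, a = star b * b.

Definition cle (R : realType) (A : cstarAlgType R) (a b : A) : Prop :=
  cpos (b - a).

Record cprobSpace (R : realType) := CProbSpace {
  calg :> cstarAlgType R;
  state : {scalar calg};
  state_pos : forall a : calg, cpos a -> 0 <= state a;
  state_one : state 1 = 1
}.

Arguments state {R c}.

Definition faithful_state (R : realType) (A : cprobSpace R) : Prop :=
  forall a : A, cpos a -> state a = 0 -> a = 0.

(* The GNS space is the Hilbert completion of the quotient [A / gns_null A]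
   with inner product induced by [(a, b) |-> state (star b * a)]; the GNS
   representation maps [a] to the continuous extension of
   [b + gns_null A |-> a * b + gns_null A].  Two bounded operators coincide as
   soon as they coincide on the dense subspace [A / gns_null A]. *)
Definition gns_null (R : realType) (A : cprobSpace R) : set A :=
  [set a | state (star a * a) = 0].

Definition gns_eq (R : realType) (A : cprobSpace R) (a a' : A) : Prop :=
  forall b : A, gns_null (a * b - a' * b).

Definition faithful_gns (R : realType) (A : cprobSpace R) : Prop :=
  forall a a' : A, gns_eq a a' -> a = a'.

Definition cprob_embedding (R : realType) (B A : cprobSpace R)
    (theta : {lrmorphism B -> A}) : Prop :=
  [/\ injective theta,
      (forall b, theta (star b) = star (theta b)) &
      (forall b, state (theta b) = state b)].

(* Not necessarily unital. *)
Record cstar_subalgebra (R : realType) (A : cstarAlgType R) (S : set A) : Prop :=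
  CStarSubalgebra {
    csub_closed : closed S;
    csub0 : S 0;
    csubD : forall a b, S a -> S b -> S (a + b);
    csubZ : forall (c : R[i]) a, S a -> S (c *: a);
    csubM : forall a b, S a -> S b -> S (a * b);
    csub_star : forall a, S a -> S (star a)
  }.

Section FreeProduct.
Variables (R : realType) (A B C : cprobSpace R).
Variables (i1 : {lrmorphism A -> C}) (i2 : {lrmorphism B -> C}).

Definition factor_map (x : A + B) : C :=
  match x with inl a => i1 a | inr b => i2 b end.

Definition centered (x : A + B) : Prop :=
  match x with inl a => state a = 0 | inr b => state b = 0 end.

Definition alternating (s : seq (A + B)) : bool :=
  sorted (fun x y => is_inl x != is_inl y) s.

Definition free_factors : Prop :=
  forall s : seq (A + B), s <> [::] -> alternating s ->
    (forall x, x \in s -> centered x) ->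
    state (\prod_(x <- s) factor_map x) = 0.

(* The reduced free product is defined only up to isomorphism: [C], together
   with [i1] and [i2], is a copy of it when the factors are free in [C] and
   generate [C], and the state of [C] has a faithful GNS representation.  Any
   two such copies are intertwined by a unique isomorphism, since freeness
   determines the joint moments. *)
Record reduced_free_product : Prop := ReducedFreeProduct {
  rfp_embed1 : cprob_embedding i1;
  rfp_embed2 : cprob_embedding i2;
  rfp_free : free_factors;
  rfp_generated : forall S : set C, cstar_subalgebra S ->
    range i1 `<=` S -> range i2 `<=` S -> S = setT;
  rfp_gns : faithful_gns C
}.

End FreeProduct.

Inductive star_poly (K V : Type) : Type :=
  | PVar of V
  | PCst of K
  | PAdd of star_poly K V & star_poly K V
  | PMul of star_poly K V & star_poly K V
  | PStar of star_poly K V.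

Fixpoint peval (R : realType) (A : cstarAlgType R) (V : Type) (e : V -> A)
    (p : star_poly R[i] V) : A :=
  match p with
  | PVar v => e v
  | PCst c => c%:A
  | PAdd p q => peval e p + peval e q
  | PMul p q => peval e p * peval e q
  | PStar p => star (peval e p)
  end.

(* A continuous real-valued combination of [qf_nnorm] norms and [qf_nstate]
   (complex) values of the state. *)
Record qf_formula (R : realType) (V : Type) := QfFormula {
  qf_nnorm : nat;
  qf_nstate : nat;
  qf_norm : 'I_qf_nnorm -> star_poly R[i] V;
  qf_state : 'I_qf_nstate -> star_poly R[i] V;
  qf_fun : 'rV[R]_qf_nnorm * 'rV[R[i]^o]_qf_nstate -> R;
  qf_continuous : continuous qf_fun
}.

Arguments qf_norm {R V} _ _.
Arguments qf_state {R V} _ _.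
Arguments qf_fun {R V} _ _.

Definition qf_eval (R : realType) (A : cprobSpace R) (V : Type)
    (Phi : qf_formula R V) (e : V -> A) : R :=
  qf_fun Phi (\row_i complex.Re `|peval e (qf_norm Phi i)|,
              \row_j state (peval e (qf_state Phi j))).

Definition unit_tuples (R : realType) (A : cstarAlgType R) (n : nat) :
    set ('I_n -> A) :=
  [set x | forall i, `|x i| <= 1].

Definition join_env (n m : nat) (T : Type) (x : 'I_n -> T) (y : 'I_m -> T)
    (v : 'I_n + 'I_m) : T :=
  match v with inl i => x i | inr j => y j end.

(* The values [qf_eval Phi (join_env x y)] are bounded for [x], [y] in the unit
   balls; taking the infimum in [\bar R] avoids relying on the default value of
   the real infimum. *)
Definition qf_inf (R : realType) (A : cprobSpace R) (n m : nat)
    (Phi : qf_formula R ('I_n + 'I_m)) (x : 'I_n -> A) : \bar R :=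
  ereal_inf [set (qf_eval Phi (join_env x y))%:E | y in @unit_tuples R A m].

Definition existential (R : realType) (B A : cprobSpace R)
    (theta : {lrmorphism B -> A}) : Prop :=
  cprob_embedding theta /\
  forall (n m : nat) (Phi : qf_formula R ('I_n + 'I_m)) (a : 'I_n -> B),
    @unit_tuples R B n a -> qf_inf Phi a = qf_inf Phi (theta \o a).

Definition selfless (R : realType) (A : cprobSpace R) : Prop :=
  [/\ (exists a : A, forall c : R[i], a <> c%:A),
      faithful_gns A &
      exists (C : cprobSpace R) (i1 i2 : {lrmorphism A -> C}),
        reduced_free_product i1 i2 /\ existential i1].

Record closed_ideal (R : realType) (A : cstarAlgType R) (I : set A) : Prop :=
  ClosedIdeal {
    ideal_closed : closed I;
    ideal0 : I 0;
    idealD : forall a b, I a -> I b -> I (a + b);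
    idealMl : forall a b, I b -> I (a * b);
    idealMr : forall a b, I a -> I (a * b)
  }.

Definition simple_cstar (R : realType) (A : cstarAlgType R) : Prop :=
  forall I : set A, closed_ideal I -> I = [set 0] \/ I = setT.

Definition hereditary_subalgebra (R : realType) (A : cstarAlgType R)
    (S : set A) : Prop :=
  cstar_subalgebra S /\ forall a b, cpos a -> cle a b -> S b -> S a.

Definition projection (R : realType) (A : cstarAlgType R) (p : A) : Prop :=
  star p = p /\ p * p = p.

Definition mvn_equiv (R : realType) (A : cstarAlgType R) (p q : A) : Prop :=
  exists v : A, star v * v = p /\ v * star v = q.

Definition infinite_projection (R : realType) (A : cstarAlgType R) (p : A) :
    Prop :=
  projection p /\
  exists q, [/\ projection q, cle q p, q <> p & mvn_equiv p q].

Definition purely_infinite (R : realType) (A : cstarAlgType R) : Prop :=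
  forall S : set A, hereditary_subalgebra S -> S <> [set 0] ->
    exists p, S p /\ infinite_projection p.

(* Main.v *)
Require Import Defs.
From mathcomp Require Import all_boot all_order all_algebra.
From mathcomp Require Import all_classical all_reals all_analysis.
From mathcomp Require Import complex ring lra.
From Stdlib Require Ncring Ncring_tac.
Set Implicit Arguments.
Unset Strict Implicit.
Unset Printing Implicit Defensive.
Import Order.TTheory GRing.Theory Num.Theory.
Import numFieldNormedType.Exports.
Local Open Scope classical_set_scope.
Local Open Scope ring_scope.
Local Open Scope complex_scope.

(** Write [phi] for the state, [norm2 x] for the square root of [phi (star x * x)],
    and [C] for the reduced free product of [A] with itself, with first and
    second embeddings [i1] and [i2].  Everything reduces to [compress_to_one]:
    for every nonzero [a] in [A] there is [x] with [star (a * x) * (a * x) = 1].  This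
    makes every nonzero ideal contain [1]; in a nonzero hereditary subalgebra,
    which contains some self-adjoint [h <> 0], it gives an isometry [v = h x]
    with [v * star v] in the subalgebra, and this projection is infinite because [A]
    also contains a non-unitary isometry.

    To compress [a] to [1] it suffices, by existentiality, to do so up to a
    small error in [C].  Assume [phi (star a * a) = 1], as can be arranged because the
    GNS representation is faithful, and suppose that [b] in [A] satisfies
    [phi (star b * b) ~ 0] and [b * star b ~ 1].  In the free Fock-type picture, [i2 b]
    almost kills the span of the words that do not begin with a letter of the
    second factor, so the range of [i2 (star b)] almost consists of words that do
    begin with such a letter.  A centered element of the first factor maps
    these to words beginning with a letter of the first factor, which [i2 b]
    almost kills.  Hence [i2 b * i1 (star a * a) * i2 (star b) ~ i2 (b * star b) ~ 1].

    It remains to find such [b], the almost coisometries.  If [phi] is not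
    faithful, its null left ideal is nonzero; it is not self-adjoint, for it would
    then be a two-sided ideal killed by the GNS representation.  So there is [b]
    with [phi (star b * b) = 0] and [phi (b * star b) = 1].  The element
    [b' = (i1 b + i2 b) / sqrt 2] of [C] has the same two properties, and as the
    cross terms vanish, [b' * star b' - 1] is the average of the two free copies of
    [x = b * star b - 1].  An estimate of Haagerup-Voiculescu type bounds the norm of
    this average by [(cnrm x + 4 * norm2 x) / 2] ([cnrm_free_sum]), while its
    2-norm is [norm2 x / sqrt 2].  Existentiality brings [b'] back into [A]
    approximately, and iteration makes [b * star b] converge to [1].

    Norm bounds in [C] are obtained on the dense span of the words, because the
    norm of an element is at most its norm in a faithful GNS representation
    ([cnrm_le_of_gns_bound]); the little functional calculus that this requires
    is derived from the existence of the square root of [1 - u] for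
    [cnrm u <= 1]. *)

(** * Normalization in noncommutative rings *)

Section NoncommutativeRing.
Variable A : nzRingType.

#[global] Instance nzring_ops :
  @Ncring.Ring_ops A 0 1 +%R *%R (fun x y => x - y) (@GRing.opp A) eq := {}.

#[global] Instance nzring_ncring : Ncring.Ring (Ro := nzring_ops).
Proof.
split; rewrite /Algebra_syntax.addition /Algebra_syntax.multiplication
  /Algebra_syntax.subtraction /Algebra_syntax.opposite /Algebra_syntax.equality
  /Algebra_syntax.zero /Algebra_syntax.one
  /Ncring.add_notation /Ncring.mul_notation /Ncring.sub_notation
  /Ncring.opp_notation /Ncring.eq_notation /Ncring.zero_notation
  /Ncring.one_notation.
- by split => // x y z -> ->.
- by move=> ? ? -> ? ? ->.
- by move=> ? ? -> ? ? ->.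
- by move=> ? ? -> ? ? ->.
- by move=> ? ? ->.
- exact: add0r.
- exact: addrC.
- exact: addrA.
- exact: mul1r.
- exact: mulr1.
- exact: mulrA.
- exact: mulrDl.
- by move=> x y z; rewrite mulrDr.
- by [].
- exact: subrr.
Qed.

End NoncommutativeRing.

Ltac ncring := Ncring_tac.non_commutative_ring.

(** * The real-valued norm *)

Section Norm.
Variables (R : realType) (A : cstarAlgType R).
Implicit Types (a b u v x y : A) (r e : R).

Definition cnrm a : R := complex.Re `|a|.

Lemma cnrmE a : `|a| = (cnrm a)%:C.
Proof. by rewrite /cnrm RRe_real// normr_real. Qed.

Lemma cnrm_ge0 a : 0 <= cnrm a.
Proof. by rewrite -ler0c -cnrmE. Qed.

Lemma cnrm0 : cnrm 0 = 0.
Proof. by apply: complexI; rewrite -cnrmE normr0. Qed.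

Lemma cnrm_eq0 a : cnrm a = 0 -> a = 0.
Proof. by move=> a0; apply/eqP; rewrite -normr_eq0 cnrmE a0. Qed.

Lemma cnrmD a b : cnrm (a + b) <= cnrm a + cnrm b.
Proof. by rewrite -lecR rmorphD /= -!cnrmE ler_normD. Qed.

Lemma cnrmN a : cnrm (- a) = cnrm a.
Proof. by rewrite /cnrm normrN. Qed.

Lemma cnrmB a b : cnrm (a - b) <= cnrm a + cnrm b.
Proof. by rewrite -(cnrmN b) cnrmD. Qed.

Lemma cnrm_distC a b : cnrm (a - b) = cnrm (b - a).
Proof. by rewrite -cnrmN opprB. Qed.

Lemma cnrm_dist_trans b a c :
  cnrm (a - c) <= cnrm (a - b) + cnrm (b - c).
Proof. by rewrite -(subrKA b a) cnrmD. Qed.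

Lemma cnrmM a b : cnrm (a * b) <= cnrm a * cnrm b.
Proof. by rewrite -lecR rmorphM /= -!cnrmE cnormM. Qed.

Lemma cnrmZ (c : R[i]) a : cnrm (c *: a) = complex.Re `|c| * cnrm a.
Proof.
apply: complexI; rewrite rmorphM /= -!cnrmE normrZ; congr (_ * _).
Qed.

Lemma cnrmZr r a : cnrm (r%:C *: a) = `|r| * cnrm a.
Proof. by rewrite cnrmZ normc_def /= expr0n addr0 sqrtr_sqr. Qed.

Lemma cnrm_star_mul a : cnrm (star a * a) = cnrm a ^+ 2.
Proof. by apply: complexI; rewrite rmorphXn /= -!cnrmE cnorm_star_mul. Qed.

Lemma starrC r a : star (r%:C *: a) = r%:C *: star a.
Proof. by rewrite starZ; congr (_ *: _); rewrite conj_Creal// complex_real. Qed.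

Lemma star1 : star (1 : A) = 1.
Proof. by rewrite -[LHS]mul1r -[X in X * _]starK -starM mul1r starK. Qed.

Lemma star0 : star (0 : A) = 0.
Proof. by apply: (addrI (star (0 : A))); rewrite -starD !addr0. Qed.

Lemma starN a : star (- a) = - star a.
Proof. by apply: (addrI (star a)); rewrite -starD !subrr star0. Qed.

Lemma starB a b : star (a - b) = star a - star b.
Proof. by rewrite starD starN. Qed.

Lemma cnrm_star a : cnrm (star a) = cnrm a.
Proof.
suff le b : cnrm b <= cnrm (star b).
  by apply/eqP; rewrite eq_le -{2}[a]starK !le.
have [->|b0] := eqVneq (cnrm b) 0; first exact: cnrm_ge0.
rewrite -(ler_pM2r (x := cnrm b)) ?lt_def ?b0 ?cnrm_ge0//.
by rewrite -expr2 -cnrm_star_mul cnrmM.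
Qed.

Lemma cnrm1 : cnrm (1 : A) = 1.
Proof.
have n0 : cnrm (1 : A) != 0.
  by apply/eqP => /cnrm_eq0/eqP; rewrite oner_eq0.
by apply: (mulfI n0); rewrite -expr2 -cnrm_star_mul star1 !mulr1.
Qed.

(** This is how identities pass to limits below: both sides are continuous, so
    their difference is dominated by the distance to the limit. *)
Lemma cnrm_small_eq0 a (K : R) :
  (forall e, 0 < e -> cnrm a <= K * e) -> a = 0.
Proof.
move=> small; apply: cnrm_eq0; apply/eqP; rewrite eq_le cnrm_ge0 andbT.
apply/ler_addgt0Pl => e e0; rewrite addr0.
have [K0|K0] := leP K 0.
  apply: le_trans (small _ e0) _.
  by apply: le_trans (ltW e0); rewrite mulr_le0_ge0// ltW.
apply: le_trans (small (e / K) _) _; first by rewrite divr_gt0.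
by rewrite mulrC divfK// gt_eqF.
Qed.

Lemma cauchy_seq_cvg (v : nat -> A) :
  (forall e, 0 < e -> exists N, forall m n, (N <= m)%N -> (N <= n)%N ->
     cnrm (v m - v n) < e) ->
  exists l, forall e, 0 < e -> exists N, forall n, (N <= n)%N ->
     cnrm (v n - l) < e.
Proof.
move=> cauchy_v.
have gt0c (e : R[i]) : 0 < e -> e = (complex.Re e)%:C /\ 0 < complex.Re e.
  move=> e0; rewrite -ltcR /= RRe_real ?gtr0_real//.
have : cvg (v @ \oo).
  apply: cauchy_cvg; apply/cauchy_ballP => _/posnumP[e].
  have [eE er0] := gt0c _ (gt0 e).
  have [N vN] := cauchy_v _ er0.
  exists ([set v n | n in [set n | N <= n]%N],
          [set v n | n in [set n | N <= n]%N]) => //=.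
    by split; exists N => // n /= Nn; exists n.
  move=> [x y] /= [[m Nm <-] [n Nn <-]].
  by rewrite -ball_normE /= eE cnrmE ltcR vN.
move=> /cvg_ex[/= l vl]; exists l => e e0.
have /cvgrPdist_lt/(_ e%:C) := vl.
rewrite ltcR => /(_ e0)[N _ vN]; exists N => n Nn.
by rewrite cnrm_distC -ltcR -cnrmE; apply: vN.
Qed.

Lemma closed_approx (S : set A) :
  (forall x, (forall e, 0 < e -> exists2 y, S y & cnrm (x - y) < e) -> S x) ->
  closed S.
Proof.
move=> Sap x clx; apply: Sap => e e0.
have e0c : 0 < e%:C :> R[i] by rewrite ltcR.
have [y [Sy]] := clx _ (nbhsx_ballx x _ e0c).
by rewrite -ball_normE /= cnrmE ltcR; exists y.
Qed.

End Norm.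

(** * Square roots *)

Section SquareRoot.
Variables (R : realType) (A : cstarAlgType R).
Implicit Types (a b u v x y : A) (r e : R).

Lemma half_add x : (2^-1)%:C *: x + (2^-1)%:C *: x = x.
Proof.
rewrite -scalerDl -rmorphD /= (_ : 2^-1 + 2^-1 = 1) ?scale1r//.
by rewrite [RHS]splitr mul1r.
Qed.

(** The solution [v] of [v = (u + v^2) / 2], for which [(1 - v)^2 = 1 - u], is
    obtained by iterating the right-hand side from [0].  The same iteration run
    from the scalar [1] in place of [u] majorizes the increments in norm: it is
    increasing and bounded by [1], so the iterates converge even when [cnrm u = 1], where the
    right-hand side is not a strict contraction. *)
Fixpoint sqrt_iter u n : A :=
  if n is n'.+1 then (2^-1)%:C *: (u + sqrt_iter u n' * sqrt_iter u n') else 0.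

Fixpoint sqrt_majorant n : R :=
  if n is n'.+1 then (1 + sqrt_majorant n' ^+ 2) / 2 else 0.

Lemma sqrt_majorant_ge0 n : 0 <= sqrt_majorant n.
Proof. by elim: n => //= n IH; rewrite divr_ge0// addr_ge0// exprn_ge0. Qed.

Lemma sqrt_majorant_le1 n : sqrt_majorant n <= 1.
Proof. by elim: n => //= n IH; have := sqrt_majorant_ge0 n; nra. Qed.

Lemma sqrt_majorant_cauchy e : 0 < e ->
  exists N, forall n, (N <= n)%N -> sqrt_majorant n - sqrt_majorant N < e.
Proof.
move=> e0; pose E : set R := range sqrt_majorant.
have supE : has_sup E.
  by split; [exists 0; exists 0%N | exists 1 => _ [n _ <-]; exact: sqrt_majorant_le1].
have [_ [N _ <-] ltN] := sup_adherent e0 supE.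
exists N => n Nn; suff : sqrt_majorant n <= sup E by lra.
by apply: (ub_le_sup supE.2); exists n.
Qed.

Variable u : A.
Hypothesis u1 : cnrm u <= 1.
Let v := sqrt_iter u.
Let t := sqrt_majorant.

Let v_le n : cnrm (v n) <= t n.
Proof.
elim: n => [|n IH]; first by rewrite /v /= cnrm0.
rewrite /v /t /= -/(v _) -/(t _) cnrmZr ger0_norm// mulrC ler_wpM2r//.
apply: le_trans (cnrmD _ _) _; rewrite lerD// expr2.
by apply: le_trans (cnrmM _ _) _; rewrite ler_pM// cnrm_ge0.
Qed.

Let v_stepS n : cnrm (v n.+1 - v n) <= t n.+1 - t n.
Proof.
elim: n => [|n IH]; first by rewrite subr0 [t 0%N]/= subr0 v_le.
have -> : v n.+2 - v n.+1 =
    (2^-1)%:C *: (v n.+1 * (v n.+1 - v n) + (v n.+1 - v n) * v n).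
  rewrite /v /= -/(v _) -/(v _) -/(v n.+1) -scalerBr; congr (_ *: _); ncring.
rewrite cnrmZr ger0_norm//.
have H1 := cnrmM (v n.+1) (v n.+1 - v n).
have H2 := cnrmM (v n.+1 - v n) (v n).
have H3 := cnrmD (v n.+1 * (v n.+1 - v n)) ((v n.+1 - v n) * v n).
have H4 := v_le n; have H5 := v_le n.+1.
have -> : t n.+2 - t n.+1 = 2^-1 * ((t n.+1 + t n) * (t n.+1 - t n)).
  by rewrite [t n.+2]/= [in X in _ - X]/t /=; rewrite /t /=; field.
rewrite ler_pM2l//; apply: le_trans H3 _; apply: le_trans (lerD H1 H2) _.
rewrite [X in _ + X]mulrC -mulrDl ler_pM ?addr_ge0 ?cnrm_ge0//.
exact: lerD.
Qed.

Let v_dist n m : (n <= m)%N -> cnrm (v m - v n) <= t m - t n.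
Proof.
move/subnKC => <-; elim: (m - n)%N => [|k IH].
  by rewrite addn0 !subrr cnrm0.
rewrite addnS; apply: le_trans (cnrm_dist_trans (v (n + k)) _ _) _.
by have := v_stepS (n + k); lra.
Qed.

(** As a limit of polynomials in [u], the solution commutes with whatever
    commutes with [u], and is self-adjoint if [u] is. *)
Lemma sqrt_one_sub : exists w : A, [/\ cnrm w <= 1, (1 - w) * (1 - w) = 1 - u,
  (star u = u -> star w = w) & forall x, x * u = u * x -> x * w = w * x].
Proof.
have [|w vw] := @cauchy_seq_cvg _ A v.
  move=> e e0; have [N tN] := sqrt_majorant_cauchy (divr_gt0 e0 (ltr0Sn _ 1)).
  exists N => m n Nm Nn.
  apply: le_lt_trans (cnrm_dist_trans (v N) _ _) _.
  rewrite [X in _ + X]cnrm_distC.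
  have := v_dist Nm; have := v_dist Nn.
  have := tN _ Nm; have := tN _ Nn; rewrite -/t; lra.
(* A Lipschitz function that vanishes along the iterates vanishes at the limit. *)
have lim_eq (f : A -> A) (K : R) : (forall n, f (v n) = 0) ->
    (forall n, cnrm (f w - f (v n)) <= K * cnrm (v n - w)) -> f w = 0.
  move=> f0 fK; apply: (@cnrm_small_eq0 _ _ _ `|K|) => e e0.
  have [N vN] := vw _ e0; have := fK N; rewrite f0 subr0 => /le_trans -> //.
  apply: le_trans (ler_norm _) _; rewrite normrM ler_wpM2l//.
  by rewrite ger0_norm ?cnrm_ge0// ltW// vN.
have w1 : cnrm w <= 1.
  apply/ler_addgt0Pr => e e0; have [N /(_ _ (leqnn N)) vN] := vw _ e0.
  have := v_le N; have := sqrt_majorant_le1 N; rewrite -/(t N).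
  have := cnrmB (v N) (v N - w); rewrite opprB addrC subrK.
  lra.
exists w; split=> //.
- suff : w + w - (u + w * w) = 0.
    move/subr0_eq => ww; have -> : (1 - w) * (1 - w) = 1 - (w + w - w * w) by ncring.
    by rewrite ww addrK.
  apply: (@cnrm_small_eq0 _ _ _ 4) => e e0.
  have [N vN] := vw _ e0.
  have -> : w + w - (u + w * w) = (w - v N.+1) + (w - v N.+1) +
      (v N * (v N - w) + (v N - w) * w).
    have := half_add (u + v N * v N); rewrite -[_ *: _]/(v N.+1) => vN2.
    have -> : u = v N.+1 + v N.+1 - v N * v N by rewrite vN2 addrK.
    by ncring.
  have H1 := vN _ (leqnn N); have H2 := vN _ (leqnSn N).
  have H3 := cnrmM (v N) (v N - w); have H4 := cnrmM (v N - w) w.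
  apply: le_trans (cnrmD _ _) _; apply: le_trans (lerD (cnrmD _ _) (cnrmD _ _)) _.
  rewrite (cnrm_distC w).
  have := v_le N; have := sqrt_majorant_le1 N; rewrite -/(t N).
  have := cnrm_ge0 (v N - w); have := cnrm_ge0 (v N); have := cnrm_ge0 w.
  by nra.
- move=> su; apply/subr0_eq; apply: (lim_eq (fun z => star z - z) 2).
    move=> n; apply/eqP; rewrite subr_eq0; apply/eqP.
    by elim: n => [|n IH]; rewrite /v /= ?star0// starrC starD starM -/(v n) IH su.
  move=> n; have -> : star w - w - (star (v n) - v n) = star (w - v n) - (w - v n).
    by rewrite starB; ncring.
  apply: le_trans (cnrmB _ _) _; rewrite cnrm_star cnrm_distC; lra.
- move=> x xu; apply/subr0_eq; apply: (lim_eq (fun z => x * z - z * x) (2 * cnrm x)).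
    move=> n; apply/eqP; rewrite subr_eq0; apply/eqP.
    elim: n => [|n IH]; rewrite /v /= ?mulr0 ?mul0r// -/(v n).
    by rewrite -scalerAl -scalerAr mulrDl mulrDr xu mulrA IH -!mulrA IH.
  move=> n; have -> : x * w - w * x - (x * v n - v n * x) =
      x * (w - v n) - (w - v n) * x by ncring.
  apply: le_trans (cnrmB _ _) _; rewrite (cnrm_distC (v n)).
  by have := cnrmM x (w - v n); have := cnrmM (w - v n) x; lra.
Qed.

End SquareRoot.

(** * Positive elements without spectral theory *)

Section PositiveElements.
Variables (R : realType) (A : cstarAlgType R).
Implicit Types (a b h x y : A).

Lemma cnrm_alg (r : R) : cnrm (r%:C%:A : A) = `|r|.
Proof. by rewrite cnrmZr cnrm1 mulr1. Qed.

Lemma star_alg (r : R) : star (r%:C%:A : A) = r%:C%:A.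
Proof. by rewrite starrC star1. Qed.

Lemma alg_comm (c : R[i]) x : x * c%:A = c%:A * x.
Proof. by rewrite mulr_algl mulr_algr. Qed.

(** The element [w = a + i b] satisfies [star w * w = m], so its norm is the square
    root of [m], and [a] is the real part of [w]. *)
Lemma cnrm_le_of_sum_squares a b (m : R) : star a = a -> star b = b ->
  a * b = b * a -> a * a + b * b = m%:C%:A -> 0 <= m -> cnrm a ^+ 2 <= m.
Proof.
move=> sa sb ab abm m0.
pose w := a + 'i%R *: b.
have ii : 'i%R * 'i%R = -1 :> R[i] by rewrite -expr2 sqrCi.
have sw : star w = a - 'i%R *: b by rewrite starD starZ sa sb conjCi scaleNr.
have ww : star w * w = m%:C%:A.
  rewrite sw /w mulrDr !mulrBl -!scalerAl -!scalerAr scalerA ii.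
  rewrite scaleN1r ab opprK -abm -addrA; congr (_ + _).
  by rewrite addKr.
have nw : cnrm w ^+ 2 = m by rewrite -cnrm_star_mul ww cnrm_alg ger0_norm.
have aw : a = (2^-1)%:C *: (w + star w).
  by rewrite sw /w addrACA subrr addr0 scalerDr half_add.
have : cnrm a <= cnrm w.
  rewrite aw cnrmZr ger0_norm//; have := cnrmD w (star w); rewrite cnrm_star; lra.
by rewrite -nw => ?; rewrite ler_sqr ?nnegrE ?cnrm_ge0.
Qed.

(** [1 - h^2] is the square of [1 - v], and [(1 - v)^2 + h^2 = 1]. *)
Lemma cnrm_one_sub_sqr h : star h = h -> cnrm h <= 1 -> cnrm (1 - h * h) <= 1.
Proof.
move=> sh h1.
have hh1 : cnrm (h * h) <= 1.
  by apply: le_trans (cnrmM _ _) _; rewrite mulr_ile1 ?cnrm_ge0.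
have [v [_ vv sv cv]] := sqrt_one_sub hh1.
have {}sv : star v = v by apply: sv; rewrite starM sh.
rewrite -vv; apply: le_trans (cnrmM _ _) _; rewrite -expr2.
apply: (@cnrm_le_of_sum_squares (1 - v) h) => //.
- by rewrite starB star1 sv.
- by rewrite mulrBl mulrBr mulr1 mul1r cv// mulrA.
- by rewrite vv subrK scale1r.
Qed.

Lemma cnrm_star_mul_contraction a : cnrm a <= 1 ->
  exists2 w, star w = w & 1 - star a * a = w * w.
Proof.
move=> a1; have aa1 : cnrm (star a * a) <= 1.
  by rewrite cnrm_star_mul expr_le1// cnrm_ge0.
have [v [_ vv sv _]] := sqrt_one_sub aa1.
by exists (1 - v) => //; rewrite starB star1 sv// starM starK.
Qed.

(** The order inequality [star a * a <= K^2]. *)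
Lemma star_mul_bound a (K : R) : cnrm a <= K ->
  exists w, (K ^+ 2)%:C%:A - star a * a = star w * w.
Proof.
move=> aK; have K0 : 0 <= K := le_trans (cnrm_ge0 _) aK.
have [K00|K00] := eqVneq K 0.
  exists 0; have -> : a = 0.
    by apply: cnrm_eq0; apply/eqP; rewrite eq_le cnrm_ge0 -K00 aK.
  by rewrite K00 expr0n rmorph0 scale0r !mulr0 subrr.
have [|w sw ww] := @cnrm_star_mul_contraction (K^-1%:C *: a).
  by rewrite cnrmZr ger0_norm ?invr_ge0// mulrC ler_pdivrMr ?mul1r// lt_def K00.
exists (K%:C *: w); rewrite starrC -scalerAl -scalerAr scalerA sw -ww.
rewrite starrC -scalerAl -scalerAr scalerA scalerBr scalerA -!rmorphM /=.
have -> : K * K * (K^-1 * K^-1) = 1 by field.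
by rewrite scale1r -expr2.
Qed.

End PositiveElements.

(** * The norm in a faithful GNS representation *)

Section State.
Variables (R : realType) (A : cprobSpace R).
Implicit Types (a b x y z : A).

Definition rstate a : R := complex.Re (state a).

Lemma rstateD a b : rstate (a + b) = rstate a + rstate b.
Proof. by rewrite /rstate !raddfD. Qed.

Lemma rstateB a b : rstate (a - b) = rstate a - rstate b.
Proof. by rewrite /rstate !raddfB. Qed.

Lemma rstateZ (r : R) a : rstate (r%:C *: a) = r * rstate a.
Proof.
by rewrite /rstate linearZ /=; case: (state a) => u v /=; rewrite mul0r subr0.
Qed.

Lemma rstate_pos a : 0 <= rstate (star a * a).
Proof.
have := @state_pos _ A (star a * a); rewrite lecE => /(_ _)/andP[]//.
by exists a.
Qed.

Lemma state_star_mul a : state (star a * a) = (rstate (star a * a))%:C.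
Proof.
by rewrite /rstate RRe_real// ger0_real// state_pos//; exists a.
Qed.

(** An element that is nonpositive in the GNS representation is minus a square.
    With [g] the absolute value of [h], the element [f = g + h] is twice the
    positive part of [h], and [f h f = f g f] is both nonpositive in the
    representation and of the form [star (r * f) * (r * f)], where [r^2 = g].  Faithfulness
    gives [r f = 0], hence [f = 0] and [h = - g]. *)
Lemma neg_square_of_gns_le0 (h : A) : faithful_gns A -> star h = h ->
  (forall y, rstate (star y * (h * y)) <= 0) ->
  exists r, [/\ star r = r, h = - (r * r) &
    forall x, x * h = h * x -> x * r = r * x].
Proof.
move=> faith; wlog h1 : h / cnrm h <= 1.
  move=> WL sh h_le0.
  have [n0|n0] := eqVneq (cnrm h) 0.
    exists 0; split; first exact: star0.
    - by rewrite mulr0 oppr0; apply: cnrm_eq0.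
    - by move=> x _; rewrite mulr0 mul0r.
  have np : 0 < cnrm h by rewrite lt_def n0 cnrm_ge0.
  have hE : h = (cnrm h)%:C *: ((cnrm h)^-1%:C *: h).
    by rewrite scalerA -rmorphM /= divff// scale1r.
  have [||y|r [sr rr cr]] := WL ((cnrm h)^-1%:C *: h).
  - by rewrite cnrmZr ger0_norm ?invr_ge0 ?cnrm_ge0// mulVf.
  - by rewrite starrC sh.
  - rewrite -scalerAl -scalerAr rstateZ mulr_ge0_le0// invr_ge0 ltW//.
  exists ((Num.sqrt (cnrm h))%:C *: r); split.
  - by rewrite starrC sr.
  - rewrite -scalerAl -scalerAr scalerA -rmorphM /= -expr2 sqr_sqrtr ?cnrm_ge0//.
    by rewrite -scalerN -rr -hE.
  - move=> x xh; rewrite -scalerAl -scalerAr cr//.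
    by rewrite -scalerAl -scalerAr xh.
move=> sh h_le0.
(* [h^2 = 1 - (1 - h^2)], so [1 - v] is the absolute value of [h]. *)
have [v [v1 vv sv cv]] := sqrt_one_sub (cnrm_one_sub_sqr sh h1).
have {}sv : star v = v by apply: sv; rewrite starB star1 starM sh.
have {}cv x : x * h = h * x -> x * v = v * x.
  move=> xh; apply: cv; rewrite mulrBr mulrBl mulr1 mul1r mulrA xh.
  by rewrite -mulrA xh mulrA.
have [g gE] : exists g, g = 1 - v by exists (1 - v).
have gg : g * g = h * h by rewrite gE vv opprB addrC subrK.
have gh : g * h = h * g by rewrite gE mulrBl mulrBr mul1r mulr1 cv.
have sg : star g = g by rewrite gE starB star1 sv.
have [v' [_ rr sr cr]] := sqrt_one_sub v1.
have [r rE] : exists r, r = 1 - v' by exists (1 - v').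
rewrite -rE -gE in rr.
have {}sr : star r = r by rewrite rE starB star1 sr.
have {}cr x : x * h = h * x -> x * r = r * x.
  by move=> /cv/cr xv; rewrite rE mulrBr mulrBl mulr1 mul1r xv.
pose f := g + h; have sf : star f = f by rewrite starD sg sh.
have hf : h * f = g * f by rewrite /f !mulrDr gg gh addrC.
have rf0 : r * f = 0.
  apply: faith => y; rewrite mul0r subr0 /gns_null /= state_star_mul.
  suff -> : rstate (star (r * f * y) * (r * f * y)) = 0 by [].
  apply/eqP; rewrite eq_le rstate_pos andbT.
  have -> : star (r * f * y) * (r * f * y) = star (f * y) * (h * (f * y)).
    rewrite !starM sf sr (mulrA h) hf -rr; ncring.
  exact: h_le0.
have f0 : f = 0.
  apply: cnrm_eq0; apply/eqP; rewrite -sqrf_eq0 -cnrm_star_mul sf {1}/f mulrDl hf.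
  by rewrite -rr -mulrA rf0 mulr0 addr0 cnrm0.
exists r; split => //; rewrite rr; apply/eqP; rewrite -addr_eq0 addrC.
by rewrite -/f f0.
Qed.

(** An injective representation is isometric.  For [k = star a * a], both [m - k] and
    [k] are squares, of commuting self-adjoint elements [r] and [r'], so
    [r'^2 + r^2 = m] bounds [r'], whose square is [k]. *)
Lemma cnrm_le_of_gns_bound (a : A) (m : R) : faithful_gns A -> 0 <= m ->
  (forall y, rstate (star (a * y) * (a * y)) <= m * rstate (star y * y)) ->
  cnrm a ^+ 2 <= m.
Proof.
move=> faith m0 le_m; pose k := star a * a.
have sk : star k = k by rewrite starM starK.
have ky y : star y * (k * y) = star (a * y) * (a * y) by rewrite starM /k; ncring.
have [||y|r [sr rr cr]] := @neg_square_of_gns_le0 (k - m%:C%:A).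
- exact: faith.
- by rewrite starB sk star_alg.
- rewrite mulrBl mulrBr rstateB ky mulr_algl -scalerAr rstateZ subr_le0.
  exact: le_m.
have [||y|r' [sr' rr' cr']] := @neg_square_of_gns_le0 (- k).
- exact: faith.
- by rewrite starN sk.
- by rewrite mulNr mulrN ky -[- _]sub0r rstateB /rstate raddf0 sub0r oppr_le0 rstate_pos.
have {}rr' : k = r' * r' by apply: oppr_inj.
rewrite -cnrm_star_mul -/k rr' -{1}sr' cnrm_star_mul.
apply: (@cnrm_le_of_sum_squares _ _ r' r) => //.
  apply: cr; rewrite mulrBr mulrBl alg_comm; congr (_ - _).
  by rewrite rr' mulrA.
by rewrite -rr' -[r * r]opprK -rr opprB addrC subrK.
Qed.

End State.

(** * The 2-norm of a state *)

Section TwoNorm.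
Variables (R : realType) (A : cprobSpace R).
Implicit Types (a b x y z : A) (r : R).

Lemma state_star a : state (star a) = Num.conj (state a).
Proof.
have conjE (c : R[i]) : Num.conj c = complex.Re c -i* complex.Im c.
  by case: c.
have H c : complex.Im (c * state a + Num.conj c * state (star a)) = 0.
  have := state_star_mul (1 + c *: a); have := state_star_mul (c *: a).
  rewrite starD starZ star1 mulrDl mul1r mulrDr mulr1 !raddfD /= => ->.
  rewrite state_one !linearZ /=.
  move/(congr1 (@complex.Im R)); rewrite !raddfD /= add0r addr0; exact.
have H1 := H 1; have H2 := H 'i%C.
move: H1 H2; rewrite !conjE; case: (state a) => p q; case: (state (star a)) => p' q'.
rewrite /= => H1 H2.
by congr (_ +i* _); lra.
Qed.

(** The real part of the inner product of the GNS space. *)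
Definition rdot x y : R := rstate (star x * y).

Lemma rstate_star a : rstate (star a) = rstate a.
Proof. by rewrite /rstate state_star; case: (state a). Qed.

Lemma rdotC x y : rdot x y = rdot y x.
Proof. by rewrite /rdot -rstate_star starM starK. Qed.

Lemma rdotDr x y z : rdot x (y + z) = rdot x y + rdot x z.
Proof. by rewrite /rdot mulrDr rstateD. Qed.

Lemma rdotDl x y z : rdot (x + y) z = rdot x z + rdot y z.
Proof. by rewrite rdotC rdotDr !(rdotC z). Qed.

Lemma rdotBr x y z : rdot x (y - z) = rdot x y - rdot x z.
Proof. by rewrite /rdot mulrBr rstateB. Qed.

Lemma rdotBl x y z : rdot (x - y) z = rdot x z - rdot y z.
Proof. by rewrite rdotC rdotBr !(rdotC z). Qed.

Lemma rdotZr r x y : rdot x (r%:C *: y) = r * rdot x y.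
Proof. by rewrite /rdot -scalerAr rstateZ. Qed.

Lemma rdotZl r x y : rdot (r%:C *: x) y = r * rdot x y.
Proof. by rewrite rdotC rdotZr rdotC. Qed.

Lemma rdot_mul a x y : rdot (a * x) y = rdot x (star a * y).
Proof. by rewrite /rdot starM mulrA. Qed.

Definition norm2 x : R := Num.sqrt (rdot x x).

Lemma norm2_ge0 x : 0 <= norm2 x. Proof. exact: sqrtr_ge0. Qed.

Lemma norm2_sqr x : norm2 x ^+ 2 = rdot x x.
Proof. by rewrite sqr_sqrtr// /rdot rstate_pos. Qed.

Lemma rdot_le x y : rdot x y <= norm2 x * norm2 y.
Proof.
have pos t : 0 <= rdot x x + 2 * t * rdot x y + t ^+ 2 * rdot y y.
  have : 0 <= rdot (x + t%:C *: y) (x + t%:C *: y) := rstate_pos _.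
  by rewrite !(rdotDl, rdotDr, rdotZl, rdotZr) (rdotC y x); lra.
have xx : 0 <= rdot x x := rstate_pos _.
have yy : 0 <= rdot y y := rstate_pos _.
suff CS : rdot x y ^+ 2 <= rdot x x * rdot y y.
  apply: le_trans (ler_norm _) _.
  by rewrite -(ler_sqr (x := `|_|)) ?nnegrE ?mulr_ge0 ?norm2_ge0// real_normK ?num_real//
    exprMn !norm2_sqr.
have [y0|y0] := eqVneq (rdot y y) 0.
  suff -> : rdot x y = 0 by rewrite y0 expr0n mulr0.
  apply/eqP/negPn/negP => xy0; have := pos (- (rdot x x + 1) / (2 * rdot x y)).
  rewrite y0 (_ : 2 * (_ / _) * _ = - (rdot x x + 1)); last by field.
  lra.
have := pos (- rdot x y / rdot y y).
rewrite (_ : _ + _ = (rdot x x * rdot y y - rdot x y ^+ 2) / rdot y y); last by field.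
by rewrite pmulr_lge0 ?invr_gt0 ?lt_def ?y0// subr_ge0.
Qed.

Lemma norm2D x y : norm2 (x + y) <= norm2 x + norm2 y.
Proof.
rewrite -(@ler_sqr _ (norm2 _)) ?nnegrE ?addr_ge0 ?norm2_ge0//.
rewrite sqrrD !norm2_sqr !(rdotDl, rdotDr) (rdotC y x).
by have := rdot_le x y; lra.
Qed.

Lemma norm2N x : norm2 (- x) = norm2 x.
Proof. by rewrite /norm2 /rdot starN mulrNN. Qed.

Lemma norm2B x y : norm2 (x - y) <= norm2 x + norm2 y.
Proof. by rewrite -(norm2N y) norm2D. Qed.

Lemma norm2Z r x : norm2 (r%:C *: x) = `|r| * norm2 x.
Proof. by rewrite /norm2 rdotZl rdotZr mulrA -expr2 sqrtrM ?sqr_ge0// sqrtr_sqr. Qed.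

Lemma norm2_1 : norm2 1 = 1.
Proof. by rewrite /norm2 /rdot star1 mulr1 /rstate state_one sqrtr1. Qed.

Lemma norm2M a y : norm2 (a * y) <= cnrm a * norm2 y.
Proof.
rewrite -(@ler_sqr _ (norm2 _)) ?nnegrE ?mulr_ge0 ?norm2_ge0 ?cnrm_ge0//.
rewrite exprMn !norm2_sqr.
have [w ww] := star_mul_bound (lexx (cnrm a)).
have : 0 <= rstate (star (w * y) * (w * y)) := rstate_pos _.
rewrite starM -mulrA (mulrA (star w)) -ww mulrBl mulrBr rstateB mulr_algl -scalerAr.
by rewrite rstateZ /rdot starM !mulrA subr_ge0.
Qed.

Lemma norm2_le_cnrm x : norm2 x <= cnrm x.
Proof. by rewrite -[x in norm2 x]mulr1 (le_trans (norm2M _ _))// norm2_1 mulr1. Qed.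

Lemma rstate_le_norm2 x : `|rstate x| <= norm2 x.
Proof.
suff le z : rstate z <= norm2 z.
  by rewrite ler_norml le andbT -norm2N lerNl -[- rstate x]sub0r
    -{1}[0](raddf0 (@complex.Re R)) -(raddf0 (@state _ A)) -/(rstate 0) -rstateB sub0r le.
by have := rdot_le 1 z; rewrite norm2_1 mul1r /rdot star1 mul1r.
Qed.

Lemma norm2_eq_of_sqr x r : 0 <= r -> rdot x x = r ^+ 2 -> norm2 x = r.
Proof. by move=> r0 xr; rewrite /norm2 xr sqrtr_sqr ger0_norm. Qed.

(** For the GNS norm it is enough to test on a dense set, since both sides of the
    bound are continuous for the norm. *)
Lemma cnrm_le_of_dense_bound (D : set A) (a : A) (m : R) :
  faithful_gns A -> 0 <= m ->
  (forall x e, 0 < e -> exists2 y, D y & cnrm (x - y) < e) ->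
  (forall y, D y -> norm2 (a * y) <= m * norm2 y) -> cnrm a <= m.
Proof.
move=> faith m0 dense Dm.
rewrite -(@ler_sqr _ (cnrm _)) ?nnegrE ?cnrm_ge0//.
apply: cnrm_le_of_gns_bound => // [|x]; first exact: sqr_ge0.
rewrite -/(rdot _ _) -/(rdot x x) -!norm2_sqr -exprMn ler_sqr ?nnegrE ?mulr_ge0 ?norm2_ge0//.
apply/ler_addgt0Pr => e e0.
pose K := m + cnrm a + 1; have K0 : 0 < K by have := cnrm_ge0 a; rewrite /K; lra.
have [y Dy xy] := dense x _ (divr_gt0 e0 K0).
have {}xy : K * cnrm (x - y) < e by rewrite mulrC -ltr_pdivlMr.
have -> : a * x = a * y + a * (x - y) by ncring.
apply: le_trans (norm2D _ _) _.
have H1 := Dm _ Dy; have H2 := norm2M a (x - y); have H3 := norm2_le_cnrm (x - y).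
have H4 : norm2 y <= norm2 x + norm2 (x - y) by rewrite -{1}(subKr x y) norm2B.
have H5 : m * norm2 y <= m * (norm2 x + norm2 (x - y)) by rewrite ler_wpM2l.
have H6 : m * norm2 (x - y) <= m * cnrm (x - y) by rewrite ler_wpM2l.
have H7 : cnrm a * norm2 (x - y) <= cnrm a * cnrm (x - y) by rewrite ler_wpM2l ?cnrm_ge0.
have H8 := cnrm_ge0 (x - y).
move: xy; rewrite /K; lra.
Qed.

End TwoNorm.

(** * Words in a free product *)

Section Span.
Variables (K : nzRingType) (E : lmodType K).
Implicit Types (S W : set E).

Definition subspace S : Prop :=
  S 0 /\ forall (c : K) x y, S x -> S y -> S (c *: x + y).

(** The impredicative form makes an inclusion of a span into a subspace a check on
    generators. *)
Definition lspan W : set E := [set y | forall S, subspace S -> W `<=` S -> S y].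

Lemma subspaceD S x y : subspace S -> S x -> S y -> S (x + y).
Proof. by move=> [_ SP] Sx Sy; rewrite -(scale1r x); exact: SP. Qed.

Lemma subspaceZ S (c : K) x : subspace S -> S x -> S (c *: x).
Proof. by move=> [S0 SP] Sx; rewrite -[c *: x]addr0; exact: SP. Qed.

Lemma lspan_subspace W : subspace (lspan W).
Proof.
split=> [S [S0 _] _ //|c x y Wx Wy S sS WS].
by apply: sS.2; [exact: Wx | exact: Wy].
Qed.

Lemma lspan_sub W : W `<=` lspan W.
Proof. by move=> x Wx S _; apply. Qed.

Lemma lspan_min W S : subspace S -> W `<=` S -> lspan W `<=` S.
Proof. by move=> sS WS x; apply. Qed.

End Span.

Section FreeProductWords.
Variables (R : realType) (A C : cprobSpace R) (i1 i2 : {lrmorphism A -> C}).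
Hypothesis rfp : reduced_free_product i1 i2.
Implicit Types (j : bool) (a b : A) (w y z v : C) (s : seq (A + A)).

Definition incl j : {lrmorphism A -> C} := if j then i1 else i2.

Lemma state_incl j a : state (incl j a) = state a.
Proof. by case: j; [have [] := rfp_embed1 rfp | have [] := rfp_embed2 rfp]. Qed.

Lemma star_incl j a : star (incl j a) = incl j (star a).
Proof. by case: j; [have [] := rfp_embed1 rfp | have [] := rfp_embed2 rfp]. Qed.

Lemma incl_alg j (c : R[i]) : incl j (c%:A) = c%:A.
Proof. by rewrite linearZ /= rmorph1. Qed.

Definition letter j a : A + A := if j then inl a else inr a.

Lemma letterP x : exists j a, x = letter j a.
Proof. by case: x => a; [exists true | exists false]; exists a. Qed.

Lemma is_inl_letter j a : is_inl (letter j a) = j. Proof. by case: j. Qed.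

Lemma factor_letter j a : factor_map i1 i2 (letter j a) = incl j a.
Proof. by case: j. Qed.

Lemma centered_letter j a : centered (letter j a) <-> state a = 0.
Proof. by case: j. Qed.

(** The words that do not begin with a letter of the factor [j], the empty word
    included. *)
Definition admissible j s : Prop :=
  [/\ Defs.alternating s, (forall x, x \in s -> centered x) &
      (if s is x :: _ then is_inl x != j else true)].

Definition eval_word s : C := \prod_(x <- s) factor_map i1 i2 x.

Definition words j : set C := [set eval_word s | s in admissible j].

Definition avoiding j : set C := lspan (words j).

(** In the GNS space of the free product, [avoiding j] and [starting j] are
    orthogonal complements of each other, and the factor [j] acts on it as on the
    tensor product of its own GNS space with the closure of [avoiding j]. *)
Definition starting j : set C :=
  lspan [set y | exists a w, [/\ state a = 0, words j w & y = incl j a * w]].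

Lemma words1 j : words j 1.
Proof. by exists [::]; [split | rewrite /eval_word big_nil]. Qed.

Lemma words_cons j a s : state a = 0 -> admissible j s ->
  words (~~ j) (incl j a * eval_word s).
Proof.
move=> a0 [alt_s cent_s hd_s]; exists (letter j a :: s).
  split.
  - case: s alt_s hd_s {cent_s} => // x s /= alt_s xj; rewrite /Defs.alternating /=.
    by rewrite is_inl_letter eq_sym xj.
  - by move=> x; rewrite inE => /predU1P[->|/cent_s//]; apply/centered_letter.
  - by rewrite is_inl_letter; case: j {hd_s}.
by rewrite /eval_word big_cons factor_letter.
Qed.

Lemma words_cases j w : words j w -> w = 1 \/
  exists a w', [/\ state a = 0, words (~~ j) w' & w = incl (~~ j) a * w'].
Proof.
move=> [[|x s] [alt_s cent_s hd_s] <-]; first by left; rewrite /eval_word big_nil.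
right; have [k [a xE]] := letterP x; rewrite xE in alt_s cent_s hd_s *.
rewrite is_inl_letter in hd_s; have kj : k = ~~ j by case: k hd_s {xE alt_s cent_s}; case: j.
exists a, (eval_word s); rewrite -kj; split.
- by have := cent_s (letter k a); rewrite mem_head => /(_ isT)/centered_letter.
- exists s => //; split.
  + by move: alt_s; rewrite /Defs.alternating /=; exact: path_sorted.
  + by move=> y ys; apply: cent_s; rewrite inE ys orbT.
  + by case: s alt_s {cent_s} => // y s /= /andP[]; rewrite is_inl_letter eq_sym.
- by rewrite /eval_word big_cons factor_letter.
Qed.

Lemma starting_avoiding j : starting j `<=` avoiding (~~ j).
Proof.
apply: lspan_min; first exact: lspan_subspace.
by move=> _ [a [_ [a0 [s adm <-] ->]]]; apply: lspan_sub; exact: words_cons.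
Qed.

Lemma avoiding1 j : avoiding j 1.
Proof. by apply: lspan_sub; exact: words1. Qed.

Lemma avoiding_split j w : avoiding j w ->
  exists (c : R[i]) v, starting (~~ j) v /\ w = c%:A + v.
Proof.
move: w; apply: (lspan_min
  (S := [set w | exists (c : R[i]) v, starting (~~ j) v /\ w = c%:A + v])).
  split.
    by exists 0, 0; split; [exact: (lspan_subspace _).1 | rewrite scale0r addr0].
  move=> c _ _ [cx [x [Vx ->]]] [cy [y [Vy ->]]].
  exists (c * cx + cy), (c *: x + y); split; first exact: (lspan_subspace _).2.
  by rewrite scalerDl scalerDr scalerA addrACA.
move=> w /words_cases[->|[a [w' [a0 Ww ->]]]].
  by exists 1, 0; split; [exact: (lspan_subspace _).1 | rewrite scale1r addr0].
by exists 0, (incl (~~ j) a * w'); split; [apply: lspan_sub; exists a, w' |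
  rewrite scale0r add0r].
Qed.

Definition star_letter (x : A + A) : A + A :=
  match x with inl a => inl (star a) | inr a => inr (star a) end.

Lemma star_eval_word s : star (eval_word s) = eval_word (rev (map star_letter s)).
Proof.
elim: s => [|x s IH]; first by rewrite /eval_word !big_nil star1.
rewrite /= rev_cons -cats1 /eval_word big_cons big_cat /= big_seq1 starM.
congr (_ * _); first exact: IH.
by case: x => a; [rewrite (star_incl true) | rewrite (star_incl false)].
Qed.

Lemma state_centering a : state (a - (state a)%:A) = 0.
Proof. by rewrite raddfB /= linearZ /= state_one mulr1 subrr. Qed.

Lemma incl_centering j a : incl j a = (state a)%:A + incl j (a - (state a)%:A).
Proof. by rewrite raddfB /= incl_alg addrC subrK. Qed.

(** The product [star w * (a * z)] is itself an alternating word with centered letters. *)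
Lemma words_free j a w z : words j w -> words j z -> state a = 0 ->
  state (star w * (incl j a * z)) = 0.
Proof.
move=> [s [alt_s cent_s hd_s] <-] [t [alt_t cent_t hd_t] <-] a0.
have -> : star (eval_word s) * (incl j a * eval_word t) =
    eval_word (rev (map star_letter s) ++ letter j a :: t).
  by rewrite star_eval_word /eval_word big_cat big_cons factor_letter.
have inl_star x : is_inl (star_letter x) = is_inl x by case: x.
apply: (rfp_free rfp).
- by case: (rev _).
- rewrite /Defs.alternating sorted_cat_cons; apply/andP; split; last first.
    case: t alt_t hd_t {cent_t} => //= x t alt_t xj.
    by rewrite is_inl_letter eq_sym xj.
  rewrite -rev_cons rev_sorted /=.
  case: s alt_s hd_s {cent_s} => //= x s alt_s xj.
  rewrite inl_star is_inl_letter xj /= path_map.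
  by apply: sub_path alt_s => y y' /=; rewrite !inl_star eq_sym.
- move=> x; rewrite mem_cat mem_rev inE => /or3P[/mapP[y ys ->]|/eqP->|/cent_t//].
    have := cent_s y ys; case: y {ys} => b /= b0; rewrite state_star b0; exact: conjC0.
  by apply/centered_letter.
Qed.

Lemma avoiding_free j a w z : avoiding j w -> avoiding j z -> state a = 0 ->
  state (star w * (incl j a * z)) = 0.
Proof.
move=> Xw Xz a0; move: w Xw; apply: lspan_min => /= [|w Ww].
  split=> [|c x y x0 y0]; first by rewrite star0 mul0r raddf0.
  by rewrite starD starZ mulrDl -scalerAl raddfD /= linearZ /= x0 y0 mulr0 addr0.
move: z Xz; apply: lspan_min => /= [|z Wz]; last exact: words_free.
split=> [|c x y x0 y0]; first by rewrite !mulr0 raddf0.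
by rewrite !mulrDr -!scalerAr raddfD /= linearZ /= x0 y0 mulr0 addr0.
Qed.

(** This is the only form in which freeness is used from here on. *)
Lemma avoiding_state j a w z : avoiding j w -> avoiding j z ->
  state (star w * (incl j a * z)) = state a * state (star w * z).
Proof.
move=> Xw Xz; rewrite incl_centering mulrDl mulrDr raddfD /=.
rewrite (avoiding_free Xw Xz (state_centering a)) addr0.
by rewrite mulr_algl -scalerAr linearZ.
Qed.

Lemma norm2_avoiding j a z : avoiding j z ->
  norm2 (incl j a * z) = norm2 a * norm2 z.
Proof.
move=> Xz; apply: norm2_eq_of_sqr; first by rewrite mulr_ge0 ?norm2_ge0.
rewrite exprMn !norm2_sqr rdot_mul star_incl mulrA -rmorphM /= {1}/rdot /rstate.
by rewrite avoiding_state// !state_star_mul -rmorphM.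
Qed.

Lemma starting_orth j v w : starting j v -> avoiding j w -> rdot w v = 0.
Proof.
move=> Vv Xw; rewrite /rdot /rstate; suff -> : state (star w * v) = 0 by [].
move: v Vv; apply: lspan_min => /= [|_ [a [z [a0 Wz ->]]]].
  split=> [|c x y x0 y0]; first by rewrite mulr0 raddf0.
  by rewrite mulrDr -scalerAr raddfD /= linearZ /= x0 y0 mulr0 addr0.
by apply: avoiding_free => //; exact: lspan_sub.
Qed.

Lemma starting_incl j a z : state a = 0 -> avoiding j z -> starting j (incl j a * z).
Proof.
move=> a0; move: z; apply: lspan_min => /= [|z Wz].
  split=> [|c x y Vx Vy]; first by rewrite mulr0; exact: (lspan_subspace _).1.
  by rewrite mulrDr -scalerAr; exact: (lspan_subspace _).2.
by apply: lspan_sub; exists a, z.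
Qed.

(** The span of all words, split along the first letter; it depends on [j] only
    through this splitting ([word_span_indep]). *)
Definition word_span j : set C :=
  [set y | exists p q, [/\ starting j p, avoiding j q & y = p + q]].

Lemma word_span_subspace j : subspace (word_span j).
Proof.
split; first by exists 0, 0; split; rewrite ?addr0//; exact: (lspan_subspace _).1.
move=> c _ _ [p [q [Vp Xq ->]]] [p' [q' [Vp' Xq' ->]]].
exists (c *: p + p'), (c *: q + q'); split; try exact: (lspan_subspace _).2.
by rewrite scalerDr addrACA.
Qed.

Lemma starting_word_span j p : starting j p -> word_span j p.
Proof. by exists p, 0; split; rewrite ?addr0//; exact: (lspan_subspace _).1. Qed.

Lemma avoiding_word_span j q : avoiding j q -> word_span j q.
Proof. by exists 0, q; split; rewrite ?add0r//; exact: (lspan_subspace _).1. Qed.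

Lemma avoiding_incl_word_span j a q : avoiding j q -> word_span j (incl j a * q).
Proof.
move=> Xq; exists (incl j (a - (state a)%:A) * q), (state a *: q); split.
- by apply: starting_incl => //; exact: state_centering.
- exact: subspaceZ (lspan_subspace _) Xq.
- by rewrite incl_centering mulrDl mulr_algl addrC.
Qed.

Lemma word_spanM j a y : word_span j y -> word_span j (incl j a * y).
Proof.
move=> [p [q [Vp Xq ->]]]; rewrite mulrDr; apply: subspaceD.
- exact: word_span_subspace.
- move: p Vp; apply: (lspan_min (S := [set p | word_span j (incl j a * p)])) => /=.
    split=> [|c x y' Tx Ty] /=; first by rewrite mulr0; exact: (word_span_subspace _).1.
    by rewrite mulrDr -scalerAr; exact: (word_span_subspace _).2.
  move=> _ [b [z [b0 Wz ->]]] /=; rewrite mulrA -rmorphM.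
  by apply: avoiding_incl_word_span; exact: lspan_sub.
- exact: avoiding_incl_word_span.
Qed.

Lemma word_span_negb j y : word_span j y -> word_span (~~ j) y.
Proof.
move=> [p [q [Vp /avoiding_split[c [v [Vv ->]]] ->]]].
apply: subspaceD; first exact: word_span_subspace.
  by apply: avoiding_word_span; exact: starting_avoiding.
apply: (word_span_subspace _).2; last exact: starting_word_span.
by apply: avoiding_word_span; exact: avoiding1.
Qed.

Lemma word_span_indep j k y : word_span j y -> word_span k y.
Proof.
by have [->//|] := eqVneq j k; case: j k => [] [] // _ /word_span_negb.
Qed.

(** The elements [m] such that [m] and [star m] map the closure of the span into
    itself form a C*-subalgebra containing both factors, hence all of [C]; apply
    this to the vector [1]. *)
Lemma word_span_dense y (e : R) : 0 < e ->
  exists2 z, word_span true z & cnrm (y - z) < e.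
Proof.
pose cl : set C := [set y | forall e, 0 < e -> exists2 z, word_span true z & cnrm (y - z) < e].
have clT z : word_span true z -> cl z.
  by move=> Tz d d0; exists z => //; rewrite subrr cnrm0.
have cl_lin (c : R[i]) x z : cl x -> cl z -> cl (c *: x + z).
  move=> clx clz d d0; pose K := complex.Re `|c| + 1.
  have c0 : 0 <= complex.Re `|c|.
    by have := normr_ge0 c; rewrite lecE => /andP[].
  have K0 : 0 < K by rewrite /K; lra.
  have [x' Tx' xx'] := clx (d / 2 / K) (divr_gt0 (divr_gt0 d0 (ltr0Sn _ 1)) K0).
  have [z' Tz' zz'] := clz (d / 2) (divr_gt0 d0 (ltr0Sn _ 1)).
  exists (c *: x' + z'); first exact: (word_span_subspace _).2.
  rewrite opprD addrACA -scalerBr.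
  apply: le_lt_trans (cnrmD _ _) _; rewrite cnrmZ.
  have : K * cnrm (x - x') < d / 2 by rewrite mulrC -ltr_pdivlMr.
  by have := cnrm_ge0 (x - x'); rewrite /K; lra.
have cl_cl x : (forall d, 0 < d -> exists2 z, cl z & cnrm (x - z) < d) -> cl x.
  move=> H d d0; have d2 : 0 < d / 2 by rewrite divr_gt0.
  have [z clz xz] := H _ d2; have [z' Tz' zz'] := clz _ d2.
  exists z' => //; apply: le_lt_trans (cnrm_dist_trans z _ _) _; lra.
have cl0 : cl 0 by apply: clT; exact: (word_span_subspace _).1.
pose M : set C := [set m | forall x, cl x -> cl (m * x) /\ cl (star m * x)].
have clM1 m x :
    (forall d, 0 < d ->
       exists2 m', (forall x, cl x -> cl (m' * x)) & cnrm (m - m') < d) ->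
    cl x -> cl (m * x).
  move=> H clx; apply: cl_cl => d d0.
  have K0 : 0 < cnrm x + 1 by have := cnrm_ge0 x; lra.
  have [m' m'P mm'] := H _ (divr_gt0 d0 K0).
  exists (m' * x); first exact: m'P.
  rewrite -mulrBl; apply: le_lt_trans (cnrmM _ _) _.
  move: mm'; rewrite ltr_pdivlMr// => mm'; have := cnrm_ge0 (m - m'); lra.
have clMi j a : M (incl j a).
  suff H b x : cl x -> cl (incl j b * x) by move=> x clx; rewrite star_incl; split; exact: H.
  move=> clx; apply: cl_cl => d d0.
  have K0 : 0 < cnrm (incl j b) + 1 by have := cnrm_ge0 (incl j b); lra.
  have [x' Tx' xx'] := clx _ (divr_gt0 d0 K0).
  exists (incl j b * x').
    apply: clT; apply: (word_span_indep (j := j)); apply: word_spanM.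
    exact: word_span_indep Tx'.
  rewrite -mulrBr; apply: le_lt_trans (cnrmM _ _) _.
  move: xx'; rewrite ltr_pdivlMr// => xx'; have := cnrm_ge0 (x - x'); lra.
have MT : M = setT.
  apply: (rfp_generated rfp); last first.
  - by move=> _ [a _ <-]; exact: (clMi false a).
  - by move=> _ [a _ <-]; exact: (clMi true a).
  split.
  - apply: closed_approx => m mM x clx.
    split; apply: clM1 => // d d0; have [m' Mm' mm'] := mM _ d0.
      by exists m' => // z /Mm'[].
    by exists (star m'); [move=> z /Mm'[] | rewrite -starB cnrm_star].
  - by move=> x _; rewrite star0 mul0r.
  - move=> m m' Mm Mm' x clx; have [? ?] := Mm x clx; have [? ?] := Mm' x clx.
    by rewrite starD !mulrDl -[m * x]scale1r -[star m * x]scale1r; split; exact: cl_lin.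
  - move=> c m Mm x clx; have [? ?] := Mm x clx.
    by rewrite starZ -!scalerAl -[c *: _]addr0 -[_ *: (star m * x)]addr0; split; exact: cl_lin.
  - move=> m m' Mm Mm' x clx; rewrite starM -!mulrA.
    by split; [apply: (Mm _ _).1; apply: (Mm' _ _).1 | apply: (Mm' _ _).2; apply: (Mm _ _).2].
  - by move=> m Mm x /Mm[]; rewrite starK.
have My : M y by rewrite MT.
have T1 : word_span true 1 by apply: avoiding_word_span; exact: avoiding1.
by have [+ _] := My 1 (clT _ T1); rewrite mulr1 => /(_ e).
Qed.

End FreeProductWords.

(** * Norm estimates in a free product *)

Section FreeProductEstimates.
Variables (R : realType) (A C : cprobSpace R) (i1 i2 : {lrmorphism A -> C}).
Hypothesis rfp : reduced_free_product i1 i2.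
Implicit Types (j : bool) (a b x : A) (y p q : C).

Local Notation inc := (incl i1 i2).
Local Notation tot := (word_span i1 i2 true).
Local Notation avoid := (avoiding i1 i2).
Local Notation start := (starting i1 i2).

Lemma word_span_split j y : tot y -> exists p q,
  [/\ start j p, avoid j q, y = p + q & norm2 p ^+ 2 + norm2 q ^+ 2 = norm2 y ^+ 2].
Proof.
move/(word_span_indep j) => [p [q [Vp Xq ->]]]; exists p, q; split=> //.
by rewrite !norm2_sqr !(rdotDl, rdotDr) (rdotC p) (starting_orth rfp Vp Xq); lra.
Qed.

Lemma norm2_incl_mul j a y : norm2 (inc j a * y) <= cnrm a * norm2 y.
Proof.
rewrite -(@ler_sqr _ (norm2 _)) ?nnegrE ?mulr_ge0 ?norm2_ge0 ?cnrm_ge0//.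
rewrite exprMn !norm2_sqr.
have [w /(congr1 (inc j))] := star_mul_bound (lexx (cnrm a)).
rewrite raddfB /= incl_alg !(rmorphM (inc j)) /= -!(star_incl rfp) => ww.
have : 0 <= rstate (star (inc j w * y) * (inc j w * y)) := rstate_pos _.
rewrite starM -mulrA (mulrA (star (inc j w))) -ww mulrBl mulrBr rstateB mulr_algl.
by rewrite -scalerAr rstateZ /rdot starM !mulrA subr_ge0.
Qed.

Lemma cnrm_le_of_word_span (c : C) (m : R) : 0 <= m ->
  (forall y, tot y -> norm2 (c * y) <= m * norm2 y) -> cnrm c <= m.
Proof.
move=> m0; apply: cnrm_le_of_dense_bound => //; first exact: rfp_gns rfp.
by move=> x e e0; exact: word_span_dense.
Qed.

Lemma cnrm_incl j a : cnrm (inc j a) <= cnrm a.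
Proof.
apply: cnrm_le_of_word_span; first exact: cnrm_ge0.
by move=> y _; exact: norm2_incl_mul.
Qed.

(** The part [q] of [star b * y] off the words beginning in the factor [j] is tested
    against itself: [rdot q q = rdot y (b * q)], and [b] acts on [q] with norm
    [norm2 b]. *)
Lemma norm2_avoiding_part j b y p q : start j p -> avoid j q ->
  inc j (star b) * y = p + q -> norm2 q <= norm2 b * norm2 y.
Proof.
move=> Vp Xq byE.
have qq : norm2 q ^+ 2 <= norm2 y * (norm2 b * norm2 q).
  rewrite -(norm2_avoiding rfp b Xq); apply: le_trans (rdot_le _ _).
  have <- : rdot (inc j (star b) * y) q = rdot y (inc j b * q).
    by rewrite rdot_mul star_incl// starK.
  by rewrite byE rdotDl (rdotC p) (starting_orth rfp Vp Xq) add0r norm2_sqr.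
have := norm2_ge0 q; rewrite le_eqVlt => /predU1P[<-|q0].
  by rewrite mulr_ge0 ?norm2_ge0.
by rewrite -(ler_pM2r q0); move: qq; rewrite expr2; lra.
Qed.

Lemma incl_star_split j b y : tot y -> exists s t, [/\ start j s, avoid j t,
  inc j (star b) * y = s + t, norm2 s <= cnrm b * norm2 y &
  norm2 t <= norm2 b * norm2 y].
Proof.
move=> Ty; have Tby : tot (inc j (star b) * y).
  by apply: (word_span_indep (j := j)); apply: word_spanM; exact: (word_span_indep j Ty).
have [s [t [Vs Xt byE nst]]] := word_span_split j Tby.
exists s, t; split=> //; last exact: (norm2_avoiding_part Vs Xt byE).
apply: (@le_trans _ _ (norm2 (inc j (star b) * y))); last first.
  by have := norm2_incl_mul j (star b) y; rewrite cnrm_star.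
by rewrite -ler_sqr ?nnegrE ?norm2_ge0// -nst lerDl sqr_ge0.
Qed.

(** Up to [norm2 b], the range of [star b] in the factor [j] is made of words
    beginning in [j], on which the other copy of [b] has norm [norm2 b]. *)
Lemma cnrm_incl_cross j b :
  cnrm (inc (~~ j) b * inc j (star b)) <= 2 * norm2 b * cnrm b.
Proof.
have b0 := norm2_ge0 b; have cb0 := cnrm_ge0 b.
apply: cnrm_le_of_word_span => [|y Ty]; first by rewrite !mulr_ge0.
have [s [t [Vs Xt byE ns nt]]] := incl_star_split j b Ty.
rewrite -(mulrA (inc (~~ j) b)) byE mulrDr; apply: le_trans (norm2D _ _) _.
rewrite (norm2_avoiding rfp b (starting_avoiding Vs)).
have H1 := norm2_incl_mul (~~ j) b t.
have H2 := ler_wpM2l b0 ns; have H3 := ler_wpM2l cb0 nt; lra.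
Qed.

(** Up to [norm2 b], the range of [star b] in the factor [j] is made of words
    beginning in [j]; the centered element [a] of the other factor turns these
    into words avoiding [j], on which [b] has norm [norm2 b]. *)
Lemma cnrm_incl_sandwich j a b : state a = 0 ->
  cnrm (inc j b * inc (~~ j) a * inc j (star b)) <= 2 * norm2 b * cnrm a * cnrm b.
Proof.
move=> a0; have b0 := norm2_ge0 b; have cb0 := cnrm_ge0 b; have ca0 := cnrm_ge0 a.
apply: cnrm_le_of_word_span => [|y Ty]; first by rewrite !mulr_ge0.
have [s [t [Vs Xt byE ns nt]]] := incl_star_split j b Ty.
have -> : inc j b * inc (~~ j) a * inc j (star b) * y =
    inc j b * (inc (~~ j) a * s) + inc j b * (inc (~~ j) a * t).
  by rewrite -!mulrDr -byE !mulrA.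
apply: le_trans (norm2D _ _) _.
have Vas : start (~~ j) (inc (~~ j) a * s).
  by apply: starting_incl => //; exact: starting_avoiding.
have Xas : avoid j (inc (~~ j) a * s).
  by have := starting_avoiding Vas; rewrite negbK.
rewrite (norm2_avoiding rfp b Xas).
have H1 := ler_wpM2l b0 (norm2_incl_mul (~~ j) a s).
have H2 := norm2_incl_mul j b (inc (~~ j) a * t).
have H3 := ler_wpM2l cb0 (norm2_incl_mul (~~ j) a t).
have H4 := ler_wpM2l (mulr_ge0 b0 ca0) ns.
have H5 := ler_wpM2l (mulr_ge0 cb0 ca0) nt.
lra.
Qed.

(** Let [p] be the part of [y] beginning in the factor [j], and split the image of
    [y] under the [j]-th copy of [x] as [u + r], with [u] the part of [x p] that
    begins in [j].  All the rest, [r], has norm at most [2 * norm2 x * norm2 y],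
    because [x] maps words avoiding [j] with norm [norm2 x], and so does its
    adjoint.  The main terms [u] for the two values of [j] are orthogonal, as are
    the parts [p], so the main terms contribute only [cnrm x] to the norm of the
    sum instead of [2 * cnrm x]. *)
Lemma cnrm_free_sum x : star x = x -> state x = 0 ->
  cnrm (i1 x + i2 x) <= cnrm x + 4 * norm2 x.
Proof.
move=> sx x0; have n0 := norm2_ge0 x; have c0 := cnrm_ge0 x.
apply: cnrm_le_of_word_span => [|y Ty]; first by lra.
have y0 := norm2_ge0 y.
have split_j j : exists p u r, [/\ start j p /\ start j u,
    rdot y p = norm2 p ^+ 2, inc j x * y = u + r,
    norm2 u <= cnrm x * norm2 p & norm2 r <= 2 * norm2 x * norm2 y].
  have [p [q [Vp Xq yE npq]]] := word_span_split j Ty.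
  have [p0 q0] := (norm2_ge0 p, norm2_ge0 q).
  have py : norm2 p <= norm2 y.
    by rewrite -ler_sqr ?nnegrE// -npq lerDl sqr_ge0.
  have qy : norm2 q <= norm2 y.
    by rewrite -ler_sqr ?nnegrE// -npq lerDr sqr_ge0.
  have Tp : tot p by apply: (word_span_indep (j := j)); exact: starting_word_span.
  have Txp : tot (inc j x * p).
    by apply: (word_span_indep (j := j)); apply: word_spanM; exact: (word_span_indep j Tp).
  have [u [w [Vu Xw xpE nuw]]] := word_span_split j Txp.
  exists p, u, (w + inc j x * q); split=> //.
  - by rewrite yE rdotDl (starting_orth rfp Vp Xq) addr0 norm2_sqr.
  - by rewrite yE mulrDr xpE addrA.
  - apply: le_trans (norm2_incl_mul j x p).
    by rewrite -ler_sqr ?nnegrE ?norm2_ge0// -nuw lerDl sqr_ge0.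
  - apply: le_trans (norm2D _ _) _; rewrite (norm2_avoiding rfp x Xq).
    have nw : norm2 w <= norm2 x * norm2 p.
      by apply: norm2_avoiding_part Vu Xw _; rewrite sx.
    have H1 := ler_wpM2l n0 py; have H2 := ler_wpM2l n0 qy; lra.
have [p [u [r [[Vp Vu] yp xE nu nr]]]] := split_j true.
have [p' [u' [r' [[Vp' Vu'] yp' xE' nu' nr']]]] := split_j false.
rewrite mulrDl -[i1 x * y]/(inc true x * y) -[i2 x * y]/(inc false x * y) xE xE'.
rewrite addrACA; apply: le_trans (norm2D _ _) _.
have H1 := norm2D r r'.
have orth v v' : start true v -> start false v' -> rdot v v' = 0.
  by move=> Vv Vv'; exact: (starting_orth rfp Vv' (starting_avoiding Vv)).
(* Bessel's inequality for the two orthogonal parts of [y]. *)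
have bessel : norm2 p ^+ 2 + norm2 p' ^+ 2 <= norm2 y ^+ 2.
  have : 0 <= rdot (y - (p + p')) (y - (p + p')) := rstate_pos _.
  rewrite !(rdotBl, rdotBr, rdotDl, rdotDr) (rdotC p y) (rdotC p' y) (rdotC p' p).
  by rewrite (orth _ _ Vp Vp') yp yp' -!norm2_sqr; lra.
suff : norm2 (u + u') <= cnrm x * norm2 y by lra.
rewrite -ler_sqr ?nnegrE ?norm2_ge0 ?mulr_ge0// exprMn.
have -> : norm2 (u + u') ^+ 2 = norm2 u ^+ 2 + norm2 u' ^+ 2.
  by rewrite !norm2_sqr !(rdotDl, rdotDr) (rdotC u' u) (orth _ _ Vu Vu'); lra.
have Hu : norm2 u ^+ 2 <= (cnrm x * norm2 p) ^+ 2
  by rewrite ler_sqr ?nnegrE ?mulr_ge0 ?norm2_ge0.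
have Hu' : norm2 u' ^+ 2 <= (cnrm x * norm2 p') ^+ 2
  by rewrite ler_sqr ?nnegrE ?mulr_ge0 ?norm2_ge0.
apply: le_trans (lerD Hu Hu') _; rewrite !exprMn -mulrDr.
by rewrite ler_wpM2l ?sqr_ge0.
Qed.

End FreeProductEstimates.

(** * Pulling elements back along an existential embedding *)

Section Realization.
Variable R : realType.

(** Substitutes [c] times the variable for each variable, which transports
    formulas on tuples in the unit ball to tuples of arbitrary norm. *)
Fixpoint poly_scale (V : Type) (c : R[i]) (p : star_poly R[i] V) :
    star_poly R[i] V :=
  match p with
  | PVar v => PMul (PCst V c) (PVar R[i] v)
  | PCst c => PCst V c
  | PAdd p q => PAdd (poly_scale c p) (poly_scale c q)
  | PMul p q => PMul (poly_scale c p) (poly_scale c q)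
  | PStar p => PStar (poly_scale c p)
  end.

Lemma peval_poly_scale (A : cstarAlgType R) (V : Type) c (e e' : V -> A) p :
  (forall v, e v = c *: e' v) -> peval e' (poly_scale c p) = peval e p.
Proof.
move=> ee; elim: p => //= [v|p -> q ->|p -> q ->|p ->]//.
by rewrite ee mulr_algl.
Qed.

Lemma continuous_sum (T : topologicalType) (I : Type) (r : seq I) (f : I -> T -> R) :
  (forall i, continuous (f i)) -> continuous (fun x => \sum_(i <- r) f i x).
Proof.
move=> cf; elim: r => [|i r IH] x.
  by under eq_fun do rewrite big_nil; exact: cvg_cst.
under eq_fun do rewrite big_cons.
by rewrite ?big_cons; apply: cvgD; [exact: cf | exact: IH].
Qed.

Lemma Re_continuous : continuous (fun z : R[i]^o => complex.Re z : R).
Proof.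
move=> z W /nbhs_ballP[e /= e0 eW]; apply/nbhs_ballP.
exists e%:C; first by rewrite /= ltcR.
move=> w zw; apply: eW; rewrite -ball_normE /= -ltcR -raddfB /=.
by apply: le_lt_trans (normc_ge_Re (z - w)) _; rewrite -ball_normE in zw.
Qed.

Definition deviation k l (r : 'I_k -> R) (s : 'I_l -> R)
    (uv : 'rV[R]_k * 'rV[R[i]^o]_l) : R :=
  \sum_i `|uv.1 0 i - r i| + \sum_j `|complex.Re (uv.2 0 j) - s j|.

Lemma deviation_continuous k l r s : continuous (@deviation k l r s).
Proof.
move=> uv; apply: cvgD; apply: continuous_sum => i {}uv.
  apply: cvg_norm; apply: cvgB; last exact: cvg_cst.
  apply: (@cvg_comp _ _ _ fst (fun M : 'rV[R]_k => M 0 i) (nbhs uv) (nbhs uv.1)).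
    exact: cvg_fst.
  exact: coord_continuous.
apply: cvg_norm; apply: cvgB; last exact: cvg_cst.
apply: (@cvg_comp _ _ _ snd
  (fun M : 'rV[R[i]^o]_l => complex.Re (M 0 i) : R) (nbhs uv) (nbhs uv.2)).
  exact: cvg_snd.
apply: (@cvg_comp _ _ _ (fun M : 'rV[R[i]^o]_l => M 0 i)
  (fun z : R[i]^o => complex.Re z : R) (nbhs uv.2) (nbhs (uv.2 0 i))).
  exact: coord_continuous.
exact: Re_continuous.
Qed.

(** Finitely many norms and real parts of states of polynomials in [y] are
    approximated by an element of the smaller space: the infimum of the total
    deviation from the prescribed values is [0] in the larger space, where [y]
    attains them, hence also in the smaller one. *)
Lemma existential_realize (B C : cprobSpace R) (theta : {lrmorphism B -> C})
    n (a : 'I_n -> B) (y : C) k l (P : 'I_k -> star_poly R[i] ('I_n + 'I_1))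
    (Q : 'I_l -> star_poly R[i] ('I_n + 'I_1)) (eps : R) :
  existential theta -> 0 < eps ->
  exists y' : B,
    (forall i, `|cnrm (peval (join_env a (fun=> y')) (P i)) -
                 cnrm (peval (join_env (theta \o a) (fun=> y)) (P i))| < eps) /\
    (forall j, `|rstate (peval (join_env a (fun=> y')) (Q j)) -
                 rstate (peval (join_env (theta \o a) (fun=> y)) (Q j))| < eps).
Proof.
move=> [emb ex] eps0.
(* [K] bounds the norms of [y] and of all parameters. *)
pose K : R := 1 + cnrm y + \sum_i cnrm (a i).
have sum0 : 0 <= \sum_i cnrm (a i) by apply: sumr_ge0 => i _; exact: cnrm_ge0.
have y0 := cnrm_ge0 y.
have K0 : 0 < K by rewrite /K; lra.
have KV (E : cstarAlgType R) (x : E) : x = K%:C *: (K^-1%:C *: x).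
  by rewrite scalerA -rmorphM /= divff ?gt_eqF// scale1r.
have unitK (E : cstarAlgType R) (x : E) : cnrm x <= K -> `|K^-1%:C *: x| <= 1.
  move=> xK; rewrite cnrmE cnrmZr -[1]/(1%:C) lecR ger0_norm ?invr_ge0 ?(ltW K0)//.
  by rewrite mulrC ler_pdivrMr// mul1r.
pose a1 i := K^-1%:C *: a i.
pose P1 i := poly_scale K%:C (P i); pose Q1 j := poly_scale K%:C (Q j).
pose r i := cnrm (peval (join_env (theta \o a) (fun=> y)) (P i)).
pose s j := rstate (peval (join_env (theta \o a) (fun=> y)) (Q j)).
pose Phi := QfFormula P1 Q1 (deviation_continuous (r := r) (s := s)).
have ua : unit_tuples a1.
  move=> i; apply: unitK; rewrite /K (bigD1 i)//=.
  have : 0 <= \sum_(j | j != i) cnrm (a j) by apply: sumr_ge0 => j _; exact: cnrm_ge0.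
  by lra.
have := ex n 1%N Phi a1 ua => inf_eq.
have evalC : qf_eval Phi (join_env (theta \o a1) (fun=> K^-1%:C *: y)) = 0.
  have thetaZ j : theta (a1 j) = K^-1%:C *: theta (a j) by rewrite /a1 linearZ.
  have eP p : peval (join_env (theta \o a1) (fun=> K^-1%:C *: y)) (poly_scale K%:C p) =
      peval (join_env (theta \o a) (fun=> y)) p.
    by apply: peval_poly_scale => -[j|j] /=; rewrite ?thetaZ -KV.
  rewrite /qf_eval /= /deviation /=; apply: eq_trans (addr0 0).
  congr (_ + _); apply: big1 => i _; rewrite mxE eP; first by rewrite /r /cnrm subrr normr0.
  by rewrite /s /rstate subrr normr0.
have : (qf_inf Phi a1 < eps%:E)%E.
  rewrite inf_eq; apply: (@le_lt_trans _ _ 0%:E); last by rewrite lte_fin.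
  apply: ereal_inf_lbound; exists (fun=> K^-1%:C *: y); last by rewrite evalC.
  by move=> i; apply: unitK; rewrite /K; lra.
move=> /ereal_inf_lt[_ [y1 uy1 <-]]; rewrite lte_fin => dev.
exists (K%:C *: y1 ord0).
have envE v : join_env a (fun=> K%:C *: y1 ord0) v = K%:C *: join_env a1 y1 v.
  by case: v => i /=; rewrite ?ord1 -?KV.
have dev1 : 0 <= \sum_i `|cnrm (peval (join_env a1 y1) (P1 i)) - r i|.
  by apply: sumr_ge0.
have dev2 : 0 <= \sum_j `|rstate (peval (join_env a1 y1) (Q1 j)) - s j|.
  by apply: sumr_ge0.
have {}dev : \sum_i `|cnrm (peval (join_env a1 y1) (P1 i)) - r i| +
    \sum_j `|rstate (peval (join_env a1 y1) (Q1 j)) - s j| < eps.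
  apply: le_lt_trans dev; rewrite /qf_eval /= /deviation /=.
  by rewrite lerD// le_eqVlt; apply/orP; left; apply/eqP; apply: eq_bigr => i _; rewrite mxE.
split=> [i|j]; rewrite -(peval_poly_scale _ envE).
- apply: le_lt_trans dev; rewrite (bigD1 i)//= -addrA lerDl addr_ge0//.
  exact: sumr_ge0.
- apply: le_lt_trans dev; rewrite [X in _ <= _ + X](bigD1 j)//= addrCA lerDl addr_ge0//.
  exact: sumr_ge0.
Qed.

End Realization.

(** * Almost coisometries with small 2-norm *)

Section AlmostCoisometries.
Variables (R : realType) (A : cprobSpace R).
Implicit Types (a b x z : A) (r d : R).

Lemma norm2_star_sqr b : norm2 (star b) ^+ 2 = rstate (b * star b).
Proof. by rewrite norm2_sqr /rdot starK. Qed.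

Lemma norm2_mulr_eq0 a b : norm2 b = 0 -> norm2 (a * b) = 0.
Proof.
move=> b0; apply/eqP; rewrite eq_le norm2_ge0 andbT.
by have := norm2M a b; rewrite b0 mulr0.
Qed.

Lemma gns_neq0 a : faithful_gns A -> a <> 0 -> exists z, norm2 (a * z) <> 0.
Proof.
move=> faith a0; apply: contra_notP a0 => nz; apply: faith => z.
rewrite mul0r subr0 /gns_null /= state_star_mul.
have -> // : rstate (star (a * z) * (a * z)) = 0.
rewrite -/(rdot _ _) -norm2_sqr.
have -> : norm2 (a * z) = 0 by apply: contrapT => az; apply: nz; exists z.
by rewrite expr0n.
Qed.

(** If the null left ideal were self-adjoint, it would absorb right
    multiplication too: for null [d], the adjoint of [d * z] is [star z * star d]. *)
Lemma exists_null_with_unit_adjoint : faithful_gns A -> ~ faithful_state A ->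
  exists b, norm2 b = 0 /\ norm2 (star b) = 1.
Proof.
move=> faith nf.
have [d [d0 nd]] : exists d : A, d <> 0 /\ norm2 d = 0.
  apply: contra_notP nf => nz a [d ->] ad.
  have d0 : norm2 d = 0 by rewrite /norm2 /rdot /rstate ad sqrtr0.
  by rewrite (_ : d = 0) ?mulr0//; apply: contrapT => dn0; apply: nz; exists d.
have [z dz] := gns_neq0 faith d0.
(* If [star d] is null, so is [star z * star d], whose adjoint [d * z] is not. *)
have [b [b0 sb0]] : exists b : A, norm2 b = 0 /\ norm2 (star b) <> 0.
  have [sd0|sd0] := eqVneq (norm2 (star d)) 0.
    exists (star z * star d); split; first exact: norm2_mulr_eq0.
    by rewrite starM !starK.
  by exists d; split=> //; exact/eqP.
exists ((norm2 (star b))^-1%:C *: b); rewrite starrC !norm2Z b0 mulr0; split=> //.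
by rewrite ger0_norm ?invr_ge0 ?norm2_ge0// mulVf//; apply/eqP.
Qed.

(** A single parameter [r] controls both the norm and the 2-norm of [b * star b - 1].
    Averaging two free copies turns bounds [10 r] and [r] into roughly
    [(10 r + 4 r) / 2 = 7 r] and [r / sqrt 2], so that, with room for the errors,
    [r] is multiplied by [9 / 10]. *)
Definition almost_coisometries r : Prop := forall d, 0 < d -> exists b,
  [/\ norm2 b < d, `|rstate (b * star b - 1)| < d,
      cnrm (b * star b - 1) < 10 * r & norm2 (b * star b - 1) < r].

Lemma almost_coisometries_le r r' :
  r <= r' -> almost_coisometries r -> almost_coisometries r'.
Proof.
by move=> rr H d /H[b [? ? ? ?]]; exists b; split=> //; lra.
Qed.

Lemma almost_coisometries_start : faithful_gns A -> ~ faithful_state A ->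
  exists2 r, 0 < r & almost_coisometries r.
Proof.
move=> faith nf; have [b [b0 sb]] := exists_null_with_unit_adjoint faith nf.
have x0 := cnrm_ge0 (b * star b - 1).
exists (1 + cnrm (b * star b - 1)); first by lra.
move=> d d0; exists b; split; rewrite ?b0//; last 2 first.
- lra.
- have := norm2_le_cnrm (b * star b - 1); lra.
rewrite rstateB -norm2_star_sqr sb expr1n.
by rewrite /rstate state_one subrr normr0.
Qed.

Section Step.
Variables (C : cprobSpace R) (i1 i2 : {lrmorphism A -> C}).
Hypotheses (rfp : reduced_free_product i1 i2) (ex : existential i1).

Local Notation inc := (incl i1 i2).

Lemma norm2_inc j a : norm2 (inc j a) = norm2 a.
Proof. by rewrite /norm2 /rdot star_incl// -rmorphM /rstate state_incl. Qed.

Lemma norm2_free_sum x : state x = 0 ->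
  norm2 (i1 x + i2 x) ^+ 2 = 2 * norm2 x ^+ 2.
Proof.
move=> x0; rewrite norm2_sqr !(rdotDl, rdotDr) (rdotC (i2 x) (i1 x)).
have st j : starting i1 i2 j (inc j x).
  by rewrite -[inc j x]mulr1; apply: starting_incl => //; exact: avoiding1.
rewrite (starting_orth rfp (st false) (starting_avoiding (st true))).
rewrite -!norm2_sqr -[i1 x]/(inc true x) -[i2 x]/(inc false x) !norm2_inc.
by lra.
Qed.

Lemma cnrm_bound b r : cnrm (b * star b - 1) < 10 * r -> cnrm b <= 1 + 10 * r.
Proof.
move=> H; have := cnrmD (b * star b - 1) 1; rewrite subrK cnrm1.
have := cnrm_star_mul (star b); rewrite starK cnrm_star => ->.
have := cnrm_ge0 (b * star b - 1); have := cnrm_ge0 b; move: H.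
move: (cnrm b) (cnrm _) => s t; nra.
Qed.

(** The average [y = (i1 b + i2 b) / sqrt 2] has [y * star y - 1] equal to the average
    of the two copies of [x = b * star b - 1] plus cross terms [E], which are small by
    [cnrm_incl_cross].  As [x] is only nearly centered, its state [e] is split
    off before the free estimates are applied. *)
Lemma free_average b (r d L : R) :
  norm2 b < d -> `|rstate (b * star b - 1)| < d ->
  cnrm (b * star b - 1) < 10 * r -> norm2 (b * star b - 1) < r ->
  cnrm b <= L ->
  exists y : C, [/\ norm2 y <= 2 * d, `|rstate (y * star y - 1)| <= d + 2 * d * L,
    cnrm (y * star y - 1) <= 7 * r + 4 * d + 2 * d * L &
    norm2 (y * star y - 1) <= 3 / 4 * r + 2 * d + 2 * d * L].
Proof.
move=> bd ed cr nr bL.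
pose q : R := (Num.sqrt 2)^-1.
have s2 : Num.sqrt 2 ^+ 2 = 2 :> R by rewrite sqr_sqrtr.
have s20 : 0 <= Num.sqrt 2 :> R := sqrtr_ge0 _.
have qq : q * q = 2^-1 by rewrite -invfM -expr2 s2.
have q0 : 0 <= q by rewrite invr_ge0.
have q1 : q <= 1 by nra.
pose x := b * star b - 1; pose e := rstate x; rewrite -/x in cr nr ed; rewrite -/e in ed.
have sx : star x = x by rewrite starB starM starK star1.
have statex : state x = e%:C.
  rewrite /e /rstate /x raddfB /= state_one -{1 3}[b]starK state_star_mul.
  by rewrite -[1]/(1%:C) -rmorphB.
pose x0 := x - e%:C%:A.
have state0 : state x0 = 0 by rewrite /x0 -statex state_centering.
have sx0 : star x0 = x0 by rewrite starB sx star_alg.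
have nx0 : norm2 x0 <= norm2 x + `|e|.
  by apply: le_trans (norm2B _ _) _; rewrite norm2Z norm2_1 mulr1.
have cx0 : cnrm x0 <= cnrm x + `|e|.
  by apply: le_trans (cnrmB _ _) _; rewrite cnrm_alg.
have sumE : i1 x + i2 x = (i1 x0 + i2 x0) + (2 * e)%:C%:A.
  rewrite /x0 !raddfB /= -[i1 _%:A]/(inc true _) -[i2 _%:A]/(inc false _) !incl_alg.
  have -> : (2 * e)%:C%:A = e%:C%:A + e%:C%:A :> C.
    by rewrite -scalerDl -rmorphD /=; congr (_%:C *: _); lra.
  ncring.
pose y : C := q%:C *: (i1 b + i2 b).
pose E : C := (2^-1)%:C *: (i2 b * i1 (star b) + i1 b * i2 (star b)).
have cross j : cnrm (inc (~~ j) b * inc j (star b)) <= 2 * d * L.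
  apply: le_trans (cnrm_incl_cross rfp j b) _.
  by have := norm2_ge0 b; have := cnrm_ge0 b; nra.
have cE : cnrm E <= 2 * d * L.
  rewrite /E cnrmZr ger0_norm//.
  have := cnrmD (i2 b * i1 (star b)) (i1 b * i2 (star b)).
  have := cross true; have := cross false; rewrite /= -/(i1 _); lra.
have yyE : y * star y - 1 = (2^-1)%:C *: (i1 x + i2 x) + E.
  rewrite /y /E starrC starD -[i1 b]/(inc true b) -[i2 b]/(inc false b) !star_incl//.
  rewrite -scalerAl -scalerAr scalerA -rmorphM qq -scalerDr /x !raddfB /= !rmorphM !rmorph1.
  have -> : (i1 b + i2 b) * (i1 (star b) + i2 (star b)) =
      i1 b * i1 (star b) - 1 + (i2 b * i2 (star b) - 1) +
      (i2 b * i1 (star b) + i1 b * i2 (star b)) + (1 + 1) by ncring.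
  by rewrite scalerDr [X in _ + X - _]scalerDr half_add addrK.
have abs_e : 0 <= `|e| by [].
exists y; rewrite yyE; split.
- rewrite norm2Z ger0_norm//.
  have := norm2D (i1 b) (i2 b).
  have := norm2_inc true b; have := norm2_inc false b => /= -> ->.
  by have := norm2_ge0 (i1 b + i2 b); nra.
- have H := le_trans (rstate_le_norm2 E) (norm2_le_cnrm E).
  rewrite rstateD rstateZ rstateD.
  have st j : rstate (inc j x) = e by rewrite /rstate state_incl.
  have := st true; have := st false => /= -> ->.
  have := ler_normD (2^-1 * (e + e)) (rstate E).
  rewrite (_ : 2^-1 * (e + e) = e); last by lra.
  lra.
- have H1 := cnrm_free_sum rfp sx0 state0.
  have H2 := cnrmD (i1 x0 + i2 x0) ((2 * e)%:C%:A).
  rewrite -sumE cnrm_alg normrM ger0_norm// in H2.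
  apply: le_trans (cnrmD _ _) _; rewrite cnrmZr ger0_norm//.
  lra.
- have H1 := norm2_free_sum state0.
  have H2 := norm2D (i1 x0 + i2 x0) ((2 * e)%:C%:A).
  rewrite -sumE norm2Z norm2_1 mulr1 normrM ger0_norm// in H2.
  have H3 : norm2 (i1 x0 + i2 x0) <= 3 / 2 * norm2 x0.
    rewrite -ler_sqr ?nnegrE ?mulr_ge0 ?norm2_ge0// H1.
    by have := sqr_ge0 (norm2 x0); nra.
  apply: le_trans (norm2D _ _) _; rewrite norm2Z ger0_norm//.
  have := norm2_le_cnrm E; lra.
Qed.

Lemma almost_coisometries_step r : 0 < r ->
  almost_coisometries r -> almost_coisometries (9 / 10 * r).
Proof.
move=> r0 Qr d d0; pose L := 1 + 10 * r.
have L1 : 1 <= L by rewrite /L; lra.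
(* [m * m] lies below [d], [r] and their squares, so [m * m / 100] is an admissible
   error for all four quantities; the accuracy [h] of [b] keeps the cross terms
   below [m / 50]. *)
pose m := Num.min (Num.min d r) 1.
have m0 : 0 < m by rewrite !lt_min d0 r0 ltr01.
have md : m <= d by rewrite !ge_min lexx.
have mr : m <= r by rewrite !ge_min lexx orbT.
have m1 : m <= 1 by rewrite ge_min lexx orbT.
pose h := m / (100 * L).
have h0 : 0 < h by rewrite divr_gt0// mulr_gt0//; lra.
have hL : h * L = m / 100 by rewrite /h; field; lra.
have hm : h <= m / 100 by rewrite -hL -[leLHS]mulr1 ler_wpM2l ?(ltW h0).
have [b [b1 b2 b3 b4]] := Qr h h0.
have [y [y1 y2 y3 y4]] := free_average b1 b2 b3 b4 (cnrm_bound b3).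
rewrite -/L -mulrA hL in y2 y3 y4.
pose Y : star_poly R[i] ('I_0 + 'I_1) := PVar _ (inr ord0).
pose W := PAdd (PMul Y (PStar Y)) (PCst _ (-1)).
pose Q (j : 'I_3) := nth Y [:: PMul (PStar Y) Y; W; PMul (PStar W) W] j.
have mm0 : 0 < m * m / 100 by rewrite divr_gt0// mulr_gt0.
have [z [zP zQ]] := existential_realize (fun=> 0) y (fun _ : 'I_1 => W) Q ex mm0.
have z3 := zP ord0; have z1 := zQ (@Ordinal 3 0 isT).
have z2 := zQ (@Ordinal 3 1 isT); have z4 := zQ (@Ordinal 3 2 isT).
rewrite /= !scaleN1r in z1 z2 z3 z4; rewrite -!/(rdot _ _) -!norm2_sqr in z1 z4.
clear zP zQ Q.
have mmd : m * m <= d * m by rewrite ler_pM2r.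
have mmr : m * m <= r * m by rewrite ler_pM2r.
have mmm : m * m <= m by rewrite -[leRHS]mul1r ler_pM2r.
have mmrr : m * m <= r * r by rewrite ler_pM// ltW.
have mmdd : m * m <= d * d by rewrite ler_pM// ltW.
have [n1 n4] := (norm2_ge0 y, norm2_ge0 (y * star y - 1)).
have sqy : norm2 y ^+ 2 <= (m / 50) ^+ 2.
  by rewrite ler_sqr ?nnegrE ?divr_ge0 ?norm2_ge0 ?(ltW m0)//; lra.
have sqw : norm2 (y * star y - 1) ^+ 2 <= (r * (79 / 100)) ^+ 2.
  by rewrite ler_sqr ?nnegrE ?mulr_ge0 ?norm2_ge0 ?(ltW r0)//; lra.
exists z; split.
- rewrite -ltr_sqr ?nnegrE ?norm2_ge0 ?(ltW d0)//.
  move: z1; rewrite ltr_norml => /andP[_]; move: sqy; rewrite !expr2; lra.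
- have := ler_normD (rstate (z * star z - 1) - rstate (y * star y - 1))
    (rstate (y * star y - 1)).
  rewrite subrK; lra.
- move: z3; rewrite ltr_norml => /andP[_]; lra.
- rewrite -ltr_sqr ?nnegrE ?norm2_ge0 ?mulr_ge0 ?(ltW r0)//.
  move: z4; rewrite ltr_norml => /andP[_]; move: sqw; rewrite !expr2; lra.
Qed.

(** Iterating the step shrinks [r] geometrically; Bernoulli's inequality for
    [(10 / 9) ^ k] supplies the number of steps. *)
Lemma almost_coisometries_all r r' : 0 < r -> 0 < r' ->
  almost_coisometries r -> almost_coisometries r'.
Proof.
move=> r0 r'0 Qr.
have [k rk] : exists k, (9 / 10) ^+ k * r <= r'.
  have bern k : (1 + k%:R / 9) * (9 / 10) ^+ k <= 1 :> R.
    elim: k => [|k IH]; first by rewrite mul0r addr0 mulr1.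
    rewrite exprS -[k.+1]addn1 natrD.
    have pk : 0 <= (9 / 10 : R) ^+ k by rewrite exprn_ge0.
    have k0 : 0 <= k%:R :> R by rewrite ler0n.
    by nra.
  have [k kr] : exists k : nat, 9 * r / r' < k%:R.
    exists (Num.truncn (9 * r / r')).+1.
    by have := truncnS_gt (9 * r / r').
  exists k; have := bern k; move: kr; rewrite ltr_pdivrMr//.
  have pk : 0 <= (9 / 10 : R) ^+ k by rewrite exprn_ge0.
  move: (k%:R) (_ ^+ k) pk => n p pk H1 H2.
  have H3 : p * (9 * r) <= p * (n * r') by rewrite ler_wpM2l// ltW.
  have H4 : (1 + n / 9) * p * r' <= 1 * r' by rewrite ler_pM2r.
  have H5 : 0 <= p * r' by rewrite mulr_ge0// ltW.
  lra.
apply: almost_coisometries_le rk _; elim: k => [|k IH]; first by rewrite mul1r.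
by rewrite exprS -mulrA; apply: almost_coisometries_step => //; rewrite mulr_gt0// exprn_gt0.
Qed.

End Step.
End AlmostCoisometries.

(** * Compressing a nonzero element to the unit *)

Section Inverse.
Variables (R : realType) (A : cstarAlgType R).
Implicit Types (c u : A).

Fixpoint neumann u n : A := if n is n'.+1 then 1 + u * neumann u n' else 0.

Lemma neumann_right_inverse u : cnrm u <= 2^-1 -> exists h, (1 - u) * h = 1.
Proof.
move=> u2; have u0 := cnrm_ge0 u; pose s := neumann u.
have stepS n : cnrm (s n.+1 - s n) <= 2^-1 ^+ n.
  elim: n => [|n IH]; first by rewrite /s /= mulr0 addr0 subr0 cnrm1.
  have -> : s n.+2 - s n.+1 = u * (s n.+1 - s n) by rewrite /s /=; ncring.
  apply: le_trans (cnrmM _ _) _; rewrite exprS.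
  by rewrite ler_pM// cnrm_ge0.
have dist n k : cnrm (s (n + k)%N - s n) <= 2 * (2^-1 ^+ n - 2^-1 ^+ (n + k)).
  elim: k => [|k IH]; first by rewrite addn0 !subrr mulr0 cnrm0.
  rewrite addnS; apply: le_trans (cnrm_dist_trans (s (n + k)%N) _ _) _.
  by have := stepS (n + k)%N; rewrite exprS; lra.
have half_cvg (e : R) : 0 < e -> exists N, 2 * 2^-1 ^+ N < e.
  move=> e0; exists (Num.truncn (2 / e)).+1.
  have small k : 2^-1 ^+ k * k%:R <= 1 :> R.
    elim: k => [|k IH]; first by rewrite mulr0 ler01.
    rewrite exprS -[k.+1]addn1 natrD.
    have : 2^-1 ^+ k <= 1 :> R by apply: exprn_ile1; lra.
    by lra.
  have := small (Num.truncn (2 / e)).+1.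
  have : 2 < (Num.truncn (2 / e)).+1%:R * e by rewrite -ltr_pdivrMr// truncnS_gt.
  move: (Num.truncn _).+1 => N ne H.
  have p0 : 0 < 2^-1 ^+ N :> R by rewrite exprn_gt0.
  have : 2^-1 ^+ N * 2 < 2^-1 ^+ N * (N%:R * e) by rewrite ltr_pM2l.
  have : 2^-1 ^+ N * N%:R * e <= 1 * e by rewrite ler_pM2r.
  lra.
have [|h sh] := @cauchy_seq_cvg _ A s.
  move=> e e0; have [N Ne] := half_cvg _ (divr_gt0 e0 (ltr0Sn _ 1)).
  exists N => m n /subnKC <- /subnKC <-.
  apply: le_lt_trans (cnrm_dist_trans (s N) _ _) _.
  rewrite [X in _ + X]cnrm_distC.
  have p k : 0 <= 2^-1 ^+ k :> R by rewrite exprn_ge0.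
  have := dist N (m - N)%N; have := dist N (n - N)%N.
  have := p (N + (m - N))%N; have := p (N + (n - N))%N; lra.
exists h; apply/subr0_eq; apply: (@cnrm_small_eq0 _ _ _ 2) => e e0.
have [N vN] := sh _ e0.
have -> : (1 - u) * h - 1 = (h - s N.+1) + u * (s N - h) by rewrite /s /=; ncring.
apply: le_trans (cnrmD _ _) _; rewrite (cnrm_distC h).
have := vN _ (leqnn N); have := vN _ (leqnSn N).
have := cnrmM u (s N - h); have := cnrm_ge0 (s N - h); nra.
Qed.

(** With [h] the inverse of [c] and [1 - v] its square root, take
    [g = (1 - v) * h]: the factors [1 - v] of [star g * c * g] pair up to copies
    of [c], so no commutation is needed. *)
Lemma inverse_square_root c : star c = c -> cnrm (c - 1) <= 2^-1 ->
  exists g, star g * c * g = 1.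
Proof.
move=> sc c1; have u2 : cnrm (1 - c) <= 2^-1 by rewrite cnrm_distC.
have [|v [_ vv sv cv]] := @sqrt_one_sub _ _ (1 - c).
  by apply: le_trans u2 _; rewrite invf_le1// ler1n.
have [h ch] := neumann_right_inverse u2.
rewrite subKr in vv ch.
have sh : star h = h.
  have hc : star h * c = 1 by rewrite -{1}sc -starM ch star1.
  by rewrite -[LHS]mulr1 -ch mulrA hc mul1r.
have {}sv : star v = v by apply: sv; rewrite starB star1 sc.
exists ((1 - v) * h); rewrite starM sh starB star1 sv -vv.
have -> : h * (1 - v) * ((1 - v) * (1 - v)) * ((1 - v) * h) =
  h * ((1 - v) * (1 - v)) * (((1 - v) * (1 - v)) * h) by rewrite !mulrA.
by rewrite vv ch mulr1 -[h * c]starK starM sh sc ch star1.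
Qed.

End Inverse.

Section Compression.
Variables (R : realType) (A : cprobSpace R).

(** In [C], the element [y = i2 (star b)] with [b] an almost coisometry satisfies
    [star y * i1 p * y = i2 (b * star b) + i2 b * i1 (p - 1) * i2 (star b)], where the first
    term is close to [1] and the second is small by [cnrm_incl_sandwich].  An
    element of [A] close enough to doing the same is corrected by an inverse
    square root. *)
Lemma compress_to_one (a : A) :
  selfless A -> ~ faithful_state A -> a <> 0 ->
  exists x, star (a * x) * (a * x) = 1.
Proof.
move=> [_ faith [C [i1 [i2 [rfp ex]]]]] nf a0.
have [z az] := gns_neq0 faith a0.
pose z1 := (norm2 (a * z))^-1%:C *: z; pose f := a * z1.
have nf1 : norm2 f = 1.
  rewrite /f /z1 -scalerAr norm2Z ger0_norm ?invr_ge0 ?norm2_ge0// mulVf//.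
  exact/eqP.
pose p := star f * f; have sp : state p = 1.
  by rewrite /p state_star_mul -/(rdot f f) -norm2_sqr nf1 expr1n.
have p0 : state (p - 1) = 0 by rewrite raddfB /= sp state_one subrr.
have [r r0 Qr] := almost_coisometries_start faith nf.
have hun : 0 < 100^-1 :> R by rewrite invr_gt0.
(* The value [1 / 100] leaves a total error below [1 / 4], and pulling back to [A]
   costs another [1 / 4]: the result is within [1 / 2] of [1]. *)
have {}Qr := almost_coisometries_all rfp ex r0 hun Qr.
pose k := 1 + cnrm (p - 1); have k1 : 1 <= k by rewrite lerDl cnrm_ge0.
have [|b [b1 _ b3 _]] := Qr (100^-1 / k).
  by rewrite divr_gt0// (lt_le_trans ltr01).
have b2 := cnrm_bound b3.
have close : cnrm (i2 b * i1 p * i2 (star b) - 1) < 4^-1.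
  have -> : i2 b * i1 p * i2 (star b) - 1 =
      i2 (b * star b - 1) + i2 b * i1 (p - 1) * i2 (star b).
    by rewrite !raddfB /= !rmorphM !rmorph1; ncring.
  have H1 := cnrm_incl rfp false (b * star b - 1).
  have H2 := cnrm_incl_sandwich rfp false b p0.
  apply: le_lt_trans (cnrmD _ _) _; rewrite /= in H1 H2.
  have H3 : norm2 b * k < 100^-1 by rewrite -ltr_pdivlMr// (lt_le_trans ltr01).
  have H4 : norm2 b * cnrm (p - 1) <= norm2 b * k.
    by rewrite ler_wpM2l ?norm2_ge0// lerDr.
  have H5 : norm2 b * cnrm (p - 1) * cnrm b <= 100^-1 * (1 + 10 * 100^-1).
    by rewrite ler_pM ?mulr_ge0 ?norm2_ge0 ?cnrm_ge0//; lra.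
  lra.
pose Y : star_poly R[i] ('I_1 + 'I_1) := PVar _ (inr ord0).
pose W := PAdd (PMul (PMul (PStar Y) (PVar _ (inl ord0))) Y) (PCst _ (-1)).
have eps0 : 0 < 4^-1 :> R by rewrite invr_gt0.
have [y [/(_ ord0) yP _]] := existential_realize (fun=> p) (i2 (star b))
  (fun _ : 'I_1 => W) (fun _ : 'I_0 => W) ex eps0.
have sb : star (i2 (star b)) = i2 b.
  by rewrite -[i2 _]/(incl i1 i2 false _) star_incl// starK.
rewrite /= !scaleN1r sb in yP.
have [||g gP] := @inverse_square_root _ _ (star y * p * y).
- have star_p : star p = p by rewrite /p starM starK.
  by rewrite starM [star (_ * p)]starM star_p starK mulrA.
- by move: yP; rewrite ltr_norml => /andP[_]; lra.
exists (z1 * y * g); rewrite -gP /p /f !starM !mulrA.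
by [].
Qed.

End Compression.

(** * Simplicity and pure infiniteness *)

Lemma projection_isometry (R : realType) (A : cstarAlgType R) (v : A) :
  star v * v = 1 -> projection (v * star v).
Proof.
by move=> vv; split; [rewrite starM starK | rewrite mulrA -(mulrA v) vv mulr1].
Qed.

(** The subprojection is the range projection of [v s], and [v * s * star v] implements
    the equivalence. *)
Lemma infinite_projection_isometry (R : realType) (A : cstarAlgType R) (v s : A) :
  star v * v = 1 -> star s * s = 1 -> s * star s <> 1 ->
  infinite_projection (v * star v).
Proof.
move=> vv ss ss1; split; first exact: projection_isometry.
have star_vs : star (v * s) = star s * star v by rewrite starM.
exists (v * s * star (v * s)); split.
- apply: projection_isometry; rewrite star_vs.
  have -> : star s * star v * (v * s) = star s * (star v * v) * s by ncring.
  by rewrite vv mulr1.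
- exists ((1 - s * star s) * star v).
  rewrite star_vs starM starK starB star1 [star (s * _)]starM starK.
  have -> : v * (1 - s * star s) * ((1 - s * star s) * star v) =
    v * (1 - s * star s - s * star s + s * (star s * s) * star s) * star v by ncring.
  by rewrite ss mulr1; ncring.
- rewrite star_vs => vssv; apply: ss1.
  have -> : s * star s = star v * v * (s * star s) * (star v * v).
    by rewrite vv mul1r mulr1.
  have -> : star v * v * (s * star s) * (star v * v) =
    star v * (v * s * (star s * star v)) * v by ncring.
  by rewrite vssv !mulrA vv mul1r vv.
- have star_m : star (v * s * star v) = v * (star s * star v).
    by rewrite starM starK star_vs.
  exists (v * s * star v); rewrite star_m star_vs; split.
    have -> : v * (star s * star v) * (v * s * star v) =
      v * (star s * (star v * v) * s) * star v by ncring.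
    by rewrite vv mulr1 ss mulr1.
  have -> : v * s * star v * (v * (star s * star v)) =
    v * s * (star v * v) * (star s * star v) by ncring.
  by rewrite vv mulr1.
Qed.

Lemma compressible_simple (R : realType) (A : cstarAlgType R) :
  (forall a : A, a <> 0 -> exists x, star (a * x) * (a * x) = 1) -> simple_cstar A.
Proof.
move=> compress I [_ I0 _ IMl IMr].
have [[a [Ia a0]]|noa] := EM (exists a, I a /\ a <> 0); last first.
  left; apply/seteqP; split=> [a Ia /=|a /= ->//].
  by apply: contrapT => a0; apply: noa; exists a.
right; apply/seteqP; split=> // c _; have [x ax] := compress a a0.
by rewrite -[c]mulr1 -ax; apply: (IMl); apply: (IMl); exact: IMr.
Qed.

(** For self-adjoint [h] in the subalgebra and [v = h w] an isometry, [v * star v] is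
    dominated by a multiple of [h^2], hence lies in the subalgebra.  It is
    infinite because it is equivalent to [1], and [1] is infinite by [s]. *)
Lemma compressible_purely_infinite (R : realType) (A : cstarAlgType R) (s : A) :
  (forall a : A, a <> 0 -> exists x, star (a * x) * (a * x) = 1) ->
  star s * s = 1 -> s * star s <> 1 -> purely_infinite A.
Proof.
move=> compress ss ss1 S [Ssub Sher] Sn0.
have [h0 [Sh0 h00]] : exists h, S h /\ h <> 0.
  apply: contra_notP Sn0 => H; apply/seteqP; split=> [a Sa /=|a /= ->].
    by apply: contrapT => a0; apply: H; exists a.
  exact: csub0.
pose h := star h0 * h0.
have Sh : S h by apply: csubM => //; exact: csub_star.
have sh : star h = h by rewrite starM starK.
have hn0 : h <> 0.
  move=> hh; apply: h00; apply: cnrm_eq0; apply/eqP.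
  by rewrite -sqrf_eq0 -cnrm_star_mul -/h hh cnrm0.
have [w vv] := compress h hn0.
have [sp pp] := projection_isometry vv.
exists (h * w * star (h * w)); split; last exact: infinite_projection_isometry ss1.
apply: (Sher _ ((cnrm (star w) ^+ 2)%:C *: (h * h))).
- by exists (h * w * star (h * w)); rewrite sp pp.
- have [u uu] := star_mul_bound (lexx (cnrm (star w))).
  have star_hw : star (h * w) = star w * h by rewrite starM sh.
  have star_uh : star (u * h) = h * star u by rewrite starM sh.
  exists (u * h); rewrite star_hw star_uh -(mulrA h (star u)) (mulrA (star u)) -uu.
  by rewrite starK mulrBl mulrBr mulr_algl -scalerAr !mulrA.
- by apply: csubZ => //; exact: csubM.
Qed.

(** Take [s = d x] with [d] self-adjoint and null.  If [s] were unitary, [1] would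
    be a left multiple of [d], hence null. *)
Lemma exists_proper_isometry (R : realType) (A : cprobSpace R) :
  faithful_gns A -> ~ faithful_state A ->
  (forall a : A, a <> 0 -> exists x, star (a * x) * (a * x) = 1) ->
  exists s : A, star s * s = 1 /\ s * star s <> 1.
Proof.
move=> faith nf compress.
have [b [nb sb]] := exists_null_with_unit_adjoint faith nf.
pose d := star b * b.
have d0 : d <> 0.
  move=> db; have b0 : b = 0.
    by apply: cnrm_eq0; apply/eqP; rewrite -sqrf_eq0 -cnrm_star_mul -/d db cnrm0.
  move: sb; rewrite b0 star0 /norm2 /rdot mulr0 /rstate raddf0 sqrtr0.
  by move/eqP; rewrite eq_sym oner_eq0.
have sd : star d = d by rewrite starM starK.
have [x dx] := compress d d0.
exists (d * x); split=> // dx1.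
have n1 : norm2 (star (x * star (d * x)) * d) = 0.
  by rewrite /d mulrA; exact: norm2_mulr_eq0.
have e1 : star (x * star (d * x)) * d = 1.
  by rewrite -[X in _ * X]sd -starM mulrA dx1 star1.
by move: n1; rewrite e1 norm2_1 => /eqP; rewrite oner_eq0.
Qed.

Theorem theorem1 (R : realType) (A : cprobSpace R)
    (A_selfless : selfless A) (A_nonfaithful : ~ faithful_state A) :
  purely_infinite A /\ simple_cstar A.
Proof.
have [_ faith _] := A_selfless.
have compress := compress_to_one A_selfless A_nonfaithful.
split; last exact: compressible_simple.
have [s [ss ss1]] := exists_proper_isometry faith A_nonfaithful compress.
exact: compressible_purely_infinite ss1.
Qed.
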